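(* Let $p>1$, $\mu\ne0$, and let $u$ be one of the solutions (Y1)–(Y6) (described in the context) of $-\square u=\mu|u|^{p-1}u$ in $\mathbb{R}^m_s$. Let $S$ be a connected component of a regular level set of $u$ (including the nodal set $\mathcal N=\{u=0\}$), and let $V$ be a connected component of the critical set $\mathcal Z=\{\nabla u=0\}$ of $u$. Then, up to isometries in $\mathbb{R}^m_s$: (i) For (Y1) and (Y4), $S$ is homothetic to either $\mathcal L_a^{m-1}$, $\mathbb{R}^{m-1}_s$, $\mathbb{R}^{m-1}_{s-1}$, $\mathcal P\times\mathbb{R}^{m-2s-\omega}$, $\mathbb{R}^{m-n}_s\times\mathbb S^{n-1}(1)$ or $\mathbb S^{k-1}(1)\times\mathbb{R}^{m-k}_{s-k}$, and only one option is possible, while $V$ is homothetic either to one of these hypersurfaces or to one of the focal varieties $\mathbb{R}^{m-k}_{s-k}$ or $\mathbb{R}^{m-n}_s$. Moreover, the blow-up for (Y4) occurs on a hypersurface homothetic to $S$. (ii) For (Y2) and (Y3), $S$ is homothetic to either $\mathbb{R}^{m-1}_s$, $\mathbb{R}^{m-1}_{s-1}$, $\mathbb{R}^{m-n}_s\times\mathbb S^{n-1}(1)$ or $\mathbb S^{k-1}(1)\times\mathbb{R}^{m-k}_{s-k}$, and only one option is possible, while $V$ is homothetic either to one of these hypersurfaces or to one of the focal varieties $\mathbb{R}^{m-k}_{s-k}$ or $\mathbb{R}^{m-n}_s$. (iii) For (Y5) and (Y6), $S$ and $V$ are homothetic to either $\mathbb S_k^{(k+n)-1}(1)\times\mathbb{R}^{m-(k+n)}_{s-k}$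 or $\mathbb H_{k-1}^{(k+n)-1}(1)\times\mathbb{R}^{m-(k+n)}_{s-k}$, where both options occur, and $V$ could also be homothetic to the algebraic variety $\mathcal C_k^{(k+n)-1}\times\mathbb{R}^{m-(k+n)}_{s-k}$. Moreover, the blow-up occurs at a hypersurface homothetic to $S$.
   Context: Fixed integers: $m\ge 3$, $1\le s<m$, $0\le k\le s$, $0\le n\le m-s$. $\mathbb{R}^m_s$ is $\mathbb{R}^m$ with points $z=(\bar t,\bar x)=(t_1,\dots,t_s,x_1,\dots,x_{m-s})$ and metric $\langle z,z\rangle=-\sum t_i^2+\sum x_j^2$; $\square=\operatorname{div}\operatorname{grad}=-\Delta_{\bar t}+\Delta_{\bar x}$. $\ell_{k,n}(z):=-\sum_{i=1}^k t_i^2+\sum_{j=1}^n x_j^2$. A nodal domain is a connected component of the complement of $\{u=0\}$. Notation for model sets: $\mathcal L_a=\mathcal L_a^{m-1}=\{z\in\mathbb{R}^m_s:\langle a,z\rangle=0\}$ for $a\ne0$. In $\mathbb{R}^N_\nu$: $\mathbb S^{N-1}_\nu(r)=\{\langle z,z\rangle=r\}$ (with $\mathbb S^{N-1}_0(r)=\mathbb S^{N-1}(r)$ the standard sphere), $\mathbb H^{N-1}_{\nu-1}(r)=\{\langle z,z\rangle=-r\}$, $\mathcal C^{N-1}_\nu=\{\langle z,z\rangle=0\}$. For $s<m-s$, $1\le\omega\le m-2s$ and signs $\epsilon_i\in\{-1,1\}$, $\mathcal P$ denotes a parabolic cylinder $\{(\bar t,\bar x)\in\mathbb{R}^{2s+\omega}_s:\sum_{i=1}^s(t_i-\epsilon_ix_i)^2+2\sum_{j=s+1}^{s+\omega}x_j=c\}$,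 $c\in\mathbb{R}$. A focal variety of an isoparametric function is a level set for a critical value. The solutions (Y1)–(Y6) are those of the form $u=v\circ\varphi$, where $\varphi$ is one of the following isoparametric functions on $\mathbb{R}^m_s$ and $v$ solves the corresponding reduced ODE on $\operatorname{Im}\varphi$ (or, for blowing-up solutions, on its maximal interval of existence), with $v(0)>0$: when $k=n=0$: either $\varphi(z)=2\langle a,z\rangle$ with $\langle a,a\rangle\ne0$, or (for $s<m-s$) $\varphi(z)=\sum_{i=1}^s(t_i-\epsilon_ix_i)^2+2\sum_{j=s+1}^{s+\omega}x_j$; the ODE is $\delta v''=-\mu|v|^{p-1}v$, $v'(0)=0$, with $\delta=4\langle a,a\rangle$, respectively $\delta=4\omega$; when $k+n\ge1$: $\varphi=\alpha\,\ell_{k,n}$ with $\alpha\in\mathbb{R}\smallsetminus\{0\}$; the ODE is $4\alpha t v''+2(k+n)\alpha v'=-\mu|v|^{p-1}v$. They have the following properties (the quotient $\frac{(k+n)+2}{(k+n)-2}$ is read as $\infty$ when $k+n=2$): (Y1) $k+n=0,1$, $p>1$: $u$ is global, bounded, sign-changing with infinitely many nodal domains. (Y2) $k+n\ge2$, $k=0$ or $n=0$, $1<p<\frac{(k+n)+2}{(k+n)-2}\le\infty$: $u$ is global, bounded, sign-changing with infinitely many nodal domains, and $|u(z)|\to0$ as $\ell_{0,n}(z)\to\infty$ (if $k=0$) or $\ell_{k,0}(z)\to-\infty$ (if $n=0$). (Y3) $k+n>2$, $k=0$ or $n=0$, $p\ge\frac{(k+n)+2}{(k+n)-2}$: $u$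 is global, bounded, positive, with a single critical point at the origin, a global maximum, and $|u(z)|\to0$ as $\ell_{0,n}(z)\to\infty$ (if $k=0$) or $\ell_{k,0}(z)\to-\infty$ (if $n=0$). (Y4) $k=0$ or $n=0$, $p>1$: $u$ is positive, with a single critical point at the origin, a global minimum, and for some $R>0$, $|u(z)|\to\infty$ as $\ell_{0,n}(z)\to R$ (if $k=0$), as $\ell_{k,0}(z)\to-R$ (if $n=0$), or, when $k=n=0$, as $\langle a,z\rangle\to\pm R$ or as $\sum_{i=1}^s|t_i+\epsilon_ix_i|^2+2\sum_{j=s+1}^{s+\omega}x_j\to\pm R$ (for suitable signs). (Y5) $k+n\ge2$, $k,n\ne0$, $1<p<\frac{(k+n)+2}{(k+n)-2}\le\infty$: $u$ is sign-changing with infinitely many nodal domains, $|u(z)|\to0$ as $\ell_{k,n}(z)\to\infty$ (or $-\infty$), and $|u(z)|\to\infty$ as $\ell_{k,n}(z)\to-R$ (or $R$) for some $R>0$. (Y6) $k+n>2$, $k,n\ne0$, $p\ge\frac{(k+n)+2}{(k+n)-2}$: $u$ is positive with a single critical point at the origin, a saddle point, $|u(z)|\to0$ as $\ell_{k,n}(z)\to\infty$ (or $-\infty$), and $|u(z)|\to\infty$ as $\ell_{k,n}(z)\to-R$ (or $R$) for some $R>0$.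
   Formalization: In (iii), S, V are homothetic to a connected component of the listed quadrics (two if k or n is 1); V is the critical part of a level component homothetic to the cone, not the cone. L_a may overlap flat hyperplanes. The single critical point is in the k+n variables. *)

(* Defs.v *)
From mathcomp Require Import all_boot all_order all_algebra.
From mathcomp Require Import all_classical all_reals all_analysis.

Set Implicit Arguments.
Unset Strict Implicit.
Unset Printing Implicit Defensive.

Import Order.TTheory GRing.Theory Num.Theory.
Import numFieldNormedType.Exports.

Local Open Scope classical_set_scope.
Local Open Scope ring_scope.

(* A point z = (t_1, ..., t_s, x_1, ..., x_(m-s)) of R^m_s is a row vector whose
   first s entries are the t_i and whose other entries are the x_j.  Indices
   are natural numbers starting from 0 (t_1 is [tc z 0] and x_1 is [xc s z 0]);
   an out-of-range coordinate is 0 and is never used below. *)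
Definition tc (R : realType) (m : nat) (z : 'rV[R]_m) (i : nat) : R :=
  oapp (z 0) 0 (insub i).

Definition xc (R : realType) (m s : nat) (z : 'rV[R]_m) (j : nat) : R :=
  tc z (s + j).

Definition mink (R : realType) (m s : nat) (z w : 'rV[R]_m) : R :=
  - (\sum_(i < s) tc z i * tc w i) + \sum_(j < m - s) xc s z j * xc s w j.

Definition ell (R : realType) (m s k n : nat) (z : 'rV[R]_m) : R :=
  - (\sum_(i < k) tc z i ^+ 2) + \sum_(j < n) xc s z j ^+ 2.

Definition parab (R : realType) (m s omega : nat) (eps : nat -> R)
    (z : 'rV[R]_m) : R :=
  \sum_(i < s) (tc z i - eps i * xc s z i) ^+ 2
  + 2 * \sum_(s <= j < s + omega) xc s z j.

Definition signs (R : realType) (s : nat) (eps : nat -> R) : Prop :=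
  forall i, (i < s)%N -> eps i = 1 \/ eps i = -1.

(** * Differential operators *)

Definition grad (R : realType) (m s : nat) (u : 'rV[R]_m -> R) (z : 'rV[R]_m)
    : 'rV[R]_m :=
  \row_(i < m) ((-1) ^+ (i < s)%N * 'D_(delta_mx 0 i) u z).

Definition div (R : realType) (m : nat) (X : 'rV[R]_m -> 'rV[R]_m)
    (z : 'rV[R]_m) : R :=
  \sum_(i < m) 'D_(delta_mx 0 i) (fun w => X w 0 i) z.

Definition box (R : realType) (m s : nat) (u : 'rV[R]_m -> R) : 'rV[R]_m -> R :=
  div (grad s u).

(* A solution is a function on an open domain Om; the values of the total
   function u outside Om are irrelevant. *)
Definition pde_solution (R : realType) (m s : nat) (p mu : R)
    (Om : set 'rV[R]_m) (u : 'rV[R]_m -> R) : Prop :=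
  open Om /\
  forall z, Om z ->
    [/\ differentiable u z,
        forall i : 'I_m, differentiable (fun w => 'D_(delta_mx 0 i) u w) z &
        - box s u z = mu * `|u z| `^ (p - 1) * u z].

(** * Solutions of the form v o phi *)

(* The isoparametric functions phi, together with the coefficients A and B of
   the reduced equation A(t) v'' + B v' = - mu |v|^(p-1) v. *)
Inductive isoparametric (R : realType) (m s k n : nat) :
    ('rV[R]_m -> R) -> (R -> R) -> R -> Prop :=
| IsoPlanar (a : 'rV[R]_m) of (k + n = 0)%N & mink s a a != 0 :
    isoparametric s k n (fun z => 2 * mink s a z) (fun=> 4 * mink s a a) 0
| IsoParabolic (omega : nat) (eps : nat -> R) of (k + n = 0)%N
    & (s < m - s)%N & (1 <= omega <= m - 2 * s)%N & signs s eps :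
    isoparametric s k n (parab s omega eps) (fun=> 4 * omega%:R) 0
| IsoQuadratic (alpha : R) of (1 <= k + n)%N & alpha != 0 :
    isoparametric s k n (fun z => alpha * ell s k n z)
      (fun t => 4 * alpha * t) (2 * (k + n)%:R * alpha).

(* Derivative relative to I, hence one-sided at an endpoint of I: the image of
   phi is a closed half-line when exactly one of k and n is 0. *)
Definition deriv_within (R : realType) (I : set R) (f : R -> R) (t d : R)
    : Prop :=
  (fun r => (f r - f t) / (r - t)) @ within I t^' --> d.

Definition ode_solution (R : realType) (k n : nat) (p mu : R) (A : R -> R)
    (B : R) (I : set R) (v : R -> R) : Prop :=
  exists v1 v2 : R -> R,
    [/\ forall t, I t -> deriv_within I v t (v1 t),
        forall t, I t -> deriv_within I v1 t (v2 t),
        {within I, continuous v2},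
        forall t, I t -> A t * v2 t + B * v1 t = - mu * `|v t| `^ (p - 1) * v t
      & (k + n = 0)%N -> v1 0 = 0].

Definition maximal_ode_solution (R : realType) (k n : nat) (p mu : R)
    (A : R -> R) (B : R) (range_phi : set R) (I : set R) (v : R -> R) : Prop :=
  [/\ is_interval I, I 0, I `<=` range_phi, ode_solution k n p mu A B I v &
      forall J w, is_interval J -> I `<=` J -> J `<=` range_phi ->
        ode_solution k n p mu A B J w -> (forall t, I t -> w t = v t) ->
        J = I].

Definition reduced_solution (R : realType) (m s k n : nat) (p mu : R)
    (phi : 'rV[R]_m -> R) (Om : set 'rV[R]_m) (u : 'rV[R]_m -> R) : Prop :=
  exists A B I v,
    [/\ isoparametric s k n phi A B,
        maximal_ode_solution k n p mu A B (range phi) I v,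
        0 < v 0,
        Om = phi @^-1` I &
        (forall z, Om z -> u z = v (phi z)) /\ pde_solution s p mu Om u].

(** * The properties describing the solutions *)

Definition bounded_on (R : realType) (m : nat) (Om : set 'rV[R]_m)
    (u : 'rV[R]_m -> R) : Prop :=
  exists M, forall z, Om z -> `|u z| <= M.

Definition positive_on (R : realType) (m : nat) (Om : set 'rV[R]_m)
    (u : 'rV[R]_m -> R) : Prop :=
  forall z, Om z -> 0 < u z.

Definition sign_changing (R : realType) (m : nat) (Om : set 'rV[R]_m)
    (u : 'rV[R]_m -> R) : Prop :=
  (exists2 z, Om z & 0 < u z) /\ (exists2 z, Om z & u z < 0).

Definition is_component (T : topologicalType) (A C : set T) : Prop :=
  exists2 z, A z & C = connected_component A z.

Definition infinitely_many_nodal_domains (R : realType) (m : nat)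
    (Om : set 'rV[R]_m) (u : 'rV[R]_m -> R) : Prop :=
  infinite_set [set D | is_component [set z | Om z /\ u z <> 0] D].

(* |u(z)| tends to G as l(z) tends to F, z in Om.  The first clause says that
   l(z) does come close to F inside Om, so that the limit is not vacuous. *)
Definition abs_tends_as (R : realType) (m : nat) (Om : set 'rV[R]_m)
    (u l : 'rV[R]_m -> R) (F G : set_system R) : Prop :=
  (forall A, F A -> exists2 z, Om z & A (l z)) /\
  (forall B, G B -> exists2 A, F A & forall z, Om z -> A (l z) -> B `|u z|).

Definition critical_set (R : realType) (m s : nat) (Om : set 'rV[R]_m)
    (u : 'rV[R]_m -> R) : set 'rV[R]_m :=
  [set z | Om z /\ grad s u z = 0].

(* If k + n > 0 then u depends only on t_1, ..., t_k, x_1, ..., x_n and its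
   critical set is invariant under translations in the other coordinates, so
   "a single critical point at the origin" is a property of u as a function of
   the k + n variables on which it depends. *)
Definition single_critical_point_at_origin (R : realType) (m s k n : nat)
    (Om : set 'rV[R]_m) (u : 'rV[R]_m -> R) : Prop :=
  critical_set s Om u 0 /\
  forall z, critical_set s Om u z ->
    (forall i, (k <= i < s)%N -> tc z i = 0) ->
    (forall j, (n <= j < m - s)%N -> xc s z j = 0) ->
    z = 0.

Definition global_max_at_origin (R : realType) (m : nat) (Om : set 'rV[R]_m)
    (u : 'rV[R]_m -> R) : Prop :=
  Om 0 /\ forall z, Om z -> u z <= u 0.

Definition global_min_at_origin (R : realType) (m : nat) (Om : set 'rV[R]_m)
    (u : 'rV[R]_m -> R) : Prop :=
  Om 0 /\ forall z, Om z -> u 0 <= u z.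

Definition saddle_at_origin (R : realType) (m : nat) (Om : set 'rV[R]_m)
    (u : 'rV[R]_m -> R) : Prop :=
  Om 0 /\
  forall U : set 'rV[R]_m, nbhs (0 : 'rV[R]_m) U ->
    (exists z, [/\ U z, Om z & u 0 < u z]) /\
    (exists z, [/\ U z, Om z & u z < u 0]).

(* The quotient is read as infinite when N = 2. *)
Definition subcritical (R : realType) (N : nat) (p : R) : Prop :=
  (2 < N)%N -> p < (N%:R + 2) / (N%:R - 2).

Definition critical_or_above (R : realType) (N : nat) (p : R) : Prop :=
  (N%:R + 2) / (N%:R - 2) <= p.

Definition vanishes_at_infinity (R : realType) (m s k n : nat)
    (Om : set 'rV[R]_m) (u : 'rV[R]_m -> R) : Prop :=
  (k = 0%N -> abs_tends_as Om u (ell s 0 n) (pinfty_nbhs R) (nbhs 0)) /\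
  (n = 0%N -> abs_tends_as Om u (ell s k 0) (ninfty_nbhs R) (nbhs 0)).

Definition decay_and_blowup (R : realType) (m s k n : nat)
    (Om : set 'rV[R]_m) (u : 'rV[R]_m -> R) : Prop :=
  exists2 r : R, 0 < r &
    (abs_tends_as Om u (ell s k n) (pinfty_nbhs R) (nbhs 0) /\
     abs_tends_as Om u (ell s k n) (nbhs (- r)) (pinfty_nbhs R)) \/
    (abs_tends_as Om u (ell s k n) (ninfty_nbhs R) (nbhs 0) /\
     abs_tends_as Om u (ell s k n) (nbhs r) (pinfty_nbhs R)).

Definition Y1 (R : realType) (m s k n : nat) (p mu : R) (Om : set 'rV[R]_m)
    (u : 'rV[R]_m -> R) : Prop :=
  exists phi,
    [/\ reduced_solution s k n p mu phi Om u,
        (k + n <= 1)%N,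
        Om = setT, bounded_on Om u &
        sign_changing Om u /\ infinitely_many_nodal_domains Om u].

Definition Y2 (R : realType) (m s k n : nat) (p mu : R) (Om : set 'rV[R]_m)
    (u : 'rV[R]_m -> R) : Prop :=
  exists phi,
    [/\ reduced_solution s k n p mu phi Om u,
        [/\ (2 <= k + n)%N, k = 0%N \/ n = 0%N & subcritical (k + n) p],
        Om = setT /\ bounded_on Om u,
        sign_changing Om u /\ infinitely_many_nodal_domains Om u &
        vanishes_at_infinity s k n Om u].

Definition Y3 (R : realType) (m s k n : nat) (p mu : R) (Om : set 'rV[R]_m)
    (u : 'rV[R]_m -> R) : Prop :=
  exists phi,
    [/\ reduced_solution s k n p mu phi Om u,
        [/\ (2 < k + n)%N, k = 0%N \/ n = 0%N & critical_or_above (k + n) p],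
        [/\ Om = setT, bounded_on Om u & positive_on Om u],
        single_critical_point_at_origin s k n Om u /\ global_max_at_origin Om u &
        vanishes_at_infinity s k n Om u].

Definition Y4 (R : realType) (m s k n : nat) (p mu : R) (Om : set 'rV[R]_m)
    (u : 'rV[R]_m -> R) : Prop :=
  exists phi,
    [/\ reduced_solution s k n p mu phi Om u,
        k = 0%N \/ n = 0%N,
        positive_on Om u,
        single_critical_point_at_origin s k n Om u /\ global_min_at_origin Om u &
        exists2 r : R, 0 < r &
          [/\ k = 0%N -> (0 < n)%N ->
                abs_tends_as Om u (ell s 0 n) (nbhs r) (pinfty_nbhs R),
              n = 0%N -> (0 < k)%N ->
                abs_tends_as Om u (ell s k 0) (nbhs (- r)) (pinfty_nbhs R) &
              (k + n = 0)%N ->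
                abs_tends_as Om u phi (nbhs r) (pinfty_nbhs R) /\
                abs_tends_as Om u phi (nbhs (- r)) (pinfty_nbhs R)]].

Definition Y5 (R : realType) (m s k n : nat) (p mu : R) (Om : set 'rV[R]_m)
    (u : 'rV[R]_m -> R) : Prop :=
  exists phi,
    [/\ reduced_solution s k n p mu phi Om u,
        [/\ (2 <= k + n)%N, (0 < k)%N, (0 < n)%N & subcritical (k + n) p],
        sign_changing Om u,
        infinitely_many_nodal_domains Om u &
        decay_and_blowup s k n Om u].

Definition Y6 (R : realType) (m s k n : nat) (p mu : R) (Om : set 'rV[R]_m)
    (u : 'rV[R]_m -> R) : Prop :=
  exists phi,
    [/\ reduced_solution s k n p mu phi Om u,
        [/\ (2 < k + n)%N, (0 < k)%N, (0 < n)%N & critical_or_above (k + n) p],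
        positive_on Om u,
        single_critical_point_at_origin s k n Om u /\ saddle_at_origin Om u &
        decay_and_blowup s k n Om u].

(** * Level sets *)

(* The nodal set {u = 0} counts as a regular level set. *)
Definition regular_component (R : realType) (m s : nat) (Om : set 'rV[R]_m)
    (u : 'rV[R]_m -> R) (S : set 'rV[R]_m) : Prop :=
  exists c : R,
    ((forall z, Om z -> u z = c -> grad s u z <> 0) \/ c = 0) /\
    is_component [set z | Om z /\ u z = c] S.

Definition blowup_set (R : realType) (m : nat) (Om : set 'rV[R]_m)
    (u : 'rV[R]_m -> R) : set 'rV[R]_m :=
  [set z0 | [/\ closure Om z0, ~ Om z0 &
     (fun z => `|u z|) @ within Om (nbhs z0) --> pinfty_nbhs R]].

(** * Model sets *)

(* The product with R^(m-(k+n))_(s-k) of a set in R^(k+n)_k is its preimage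
   under this projection onto (t_1, ..., t_k, x_1, ..., x_n). *)
Definition coord_proj (R : realType) (m s k n : nat) (z : 'rV[R]_m)
    : 'rV[R]_(k + n) :=
  row_mx (\row_(i < k) tc z i) (\row_(j < n) xc s z j).

Definition pseudosphere (R : realType) (N nu : nat) (r : R) : set 'rV[R]_N :=
  [set y | mink nu y y = r].

Definition pseudohyperbolic (R : realType) (N nu : nat) (r : R)
    : set 'rV[R]_N :=
  [set y | mink nu y y = - r].

Definition cone (R : realType) (N nu : nat) : set 'rV[R]_N :=
  [set y | mink nu y y = 0].

Definition parabolic_cylinder (R : realType) (s omega : nat) (eps : nat -> R)
    (c : R) : set 'rV[R]_(s + (s + omega)) :=
  [set y | parab s omega eps y = c].

(* R^(m-k)_(s-k) and R^(m-n)_s as subspaces of R^m_s. *)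
Definition flat_t (R : realType) (m k : nat) : set 'rV[R]_m :=
  [set z | forall i, (i < k)%N -> tc z i = 0].

Definition flat_x (R : realType) (m s n : nat) : set 'rV[R]_m :=
  [set z | forall j, (j < n)%N -> xc s z j = 0].

Variant option_name :=
  | Hyperplane_a | Flat_s | Flat_s1 | Parabolic | Flat_x_Sphere | Sphere_x_Flat.

(* The hypersurfaces of R^m_s bearing a given name: a, epsilon_i, omega and c
   are free parameters.  The factor S^(k-1)(1) is the standard sphere in the
   variables t_1, ..., t_k, whence the index 0 in [pseudosphere]. *)
Definition model (R : realType) (m s k n : nat) (o : option_name)
    (M : set 'rV[R]_m) : Prop :=
  match o with
  | Hyperplane_a => exists2 a, a != 0 & M = [set z | mink s a z = 0]
  | Flat_s => M = flat_x s 1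
  | Flat_s1 => M = @flat_t R m 1
  | Parabolic => exists omega eps c,
      [/\ (s < m - s)%N, (1 <= omega <= m - 2 * s)%N, signs s eps &
          M = coord_proj s s (s + omega) @^-1` parabolic_cylinder eps c]
  | Flat_x_Sphere => M = coord_proj s 0 n @^-1` pseudosphere 0 1
  | Sphere_x_Flat => M = coord_proj s k 0 @^-1` pseudosphere 0 1
  end.

Definition focal (R : realType) (m s k n : nat) (F : set 'rV[R]_m) : Prop :=
  ((0 < k)%N /\ F = @flat_t R m k) \/ ((0 < n)%N /\ F = flat_x s n).

Definition isometry (R : realType) (m s : nat) (g : 'rV[R]_m -> 'rV[R]_m)
    : Prop :=
  bijective g /\
  forall z w, mink s (g z - g w) (g z - g w) = mink s (z - w) (z - w).

Definition homothetic (R : realType) (m s : nat) (S M : set 'rV[R]_m) : Prop :=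
  exists g (lambda : R),
    [/\ isometry s g, 0 < lambda & S = [set g (lambda *: z) | z in M]].

(* The quadrics {<y,y> = r} and {<y,y> = -r} have two components when n = 1,
   respectively k = 1; as usual, a connected hypersurface is then compared with
   one of them. *)
Definition homothetic_to_component (R : realType) (m s : nat)
    (S M : set 'rV[R]_m) : Prop :=
  exists2 C, is_component M C & homothetic s S C.

(* Every L_a with <a,a> <> 0 is isometric to R^(m-1)_s or to R^(m-1)_(s-1);
   this is the only way in which two names may apply to one hypersurface. *)
Definition compatible (o o' : option_name) : Prop :=
  match o, o' with
  | Hyperplane_a, (Flat_s | Flat_s1) | (Flat_s | Flat_s1), Hyperplane_a => True
  | _, _ => o = o'
  end.

(* All the components S of u are homothetic to one and the same model in the
   list, and no other option is possible for any of them. *)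
Definition exactly_one_option (R : realType) (m s k n : nat)
    (Om : set 'rV[R]_m) (u : 'rV[R]_m -> R) (opts : set option_name) : Prop :=
  exists o M,
    [/\ opts o, model s k n o M,
        forall S, regular_component s Om u S -> homothetic s S M &
        forall o' M' S, opts o' -> model s k n o' M' ->
          regular_component s Om u S -> homothetic s S M' -> compatible o o'].

Definition model_or_focal (R : realType) (m s k n : nat)
    (opts : set option_name) (V : set 'rV[R]_m) : Prop :=
  (exists o M, [/\ opts o, model s k n o M & homothetic s V M]) \/
  (exists2 F, focal s k n F & homothetic s V F).

(* V is the critical part of a connected component of a level set of u which
   is homothetic to C_k^((k+n)-1) x R^(m-(k+n))_(s-k).  If k, n > 0 the gradient
   of l_{k,n} vanishes only along the vertex {0} x R^(m-(k+n))_(s-k) of the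
   cone {l_{k,n} = 0}, and the ODE gives v'(0) <> 0, so V cannot be all of it. *)
Definition critical_part_of_cone (R : realType) (m s k n : nat)
    (Om : set 'rV[R]_m) (u : 'rV[R]_m -> R) (V : set 'rV[R]_m) : Prop :=
  exists F (c : R),
    [/\ is_component [set z | Om z /\ u z = c] F,
        homothetic s F (coord_proj s k n @^-1` cone k) &
        V = F `&` critical_set s Om u].

(* Main.v *)
Require Import Defs.
From mathcomp Require Import all_boot all_order all_algebra.
From mathcomp Require Import all_classical all_reals all_analysis.
From mathcomp Require Import ring lra.
Import Order.TTheory GRing.Theory Num.Theory.
Import numFieldNormedType.Exports.
Local Open Scope classical_set_scope.
Local Open Scope ring_scope.

(** A solution is [u = v o phi], so each level set of [u] and its blow-up set
    are unions of fibres of [phi], and so is its critical set, except on the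
    fibre [phi = 0], of which it may only contain the zeros of the gradient of
    [phi].  The point is that no component meets two fibres.

    A connected subset of such a set has a connected image under [phi], that
    is, an interval; if this interval contains no nondegenerate segment, the
    subset lies in a single fibre ([component_in_fibre]).  Now if [v] is
    constant, or [v'] vanishes, on a segment off [0], then the reduced equation
    forces [v = v' = 0] there; by a Gronwall estimate [v] then vanishes all the
    way to [0], against [v 0 > 0] ([no_double_zero]).  Hence the components of
    the level sets and of the critical set are components of fibres, except for
    the zero set of the gradient of [phi] ([level_component],
    [critical_component_cases]).  No regular level meets the fibre [phi = 0]
    when [k + n > 0], because [v 0 > 0] and the gradient of [phi] vanishes at
    the origin.

    It remains to describe the fibres of the explicit functions [phi].  The
    hyperplanes and the parabolic cylinders are connected and are translates of
    one another.  If [k = 0] or [n = 0], the fibre is a cylinder over a sphere: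
    connected in at least two variables, a pair of parallel hyperplanes in one.
    If [k] and [n] are positive, it is a cylinder over a pseudosphere or a
    pseudohyperbolic space, scaled to radius one.

    That only one option is possible rests on the fact that an isometry is
    affine ([isometry_linear]), so that homotheties preserve midpoint convexity
    and central symmetry.  Hyperplanes are midpoint convex, cylinders over
    spheres are centrally symmetric and not midpoint convex, and parabolic
    cylinders are neither.  A
    hyperplane normal to a time axis and one normal to a space axis are told
    apart by the sign of the square of the normal vector.

    For [k, n > 0], regular levels on both sides of the cone [l_{k,n} = 0] exist
    because [2 t v'^2 + (mu / alpha) |v|^(p+1) / (p+1)] is monotone
    ([regular_values_near_zero]): at a critical point it only depends on the
    critical value, and [v' 0 <> 0], so that the values of [v] near [v 0] and
    different from it are regular.

    Finally, [u] blows up along the fibres over the finite endpoints of the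
    interval of existence that do not belong to it ([blowup_components]). *)

Set Implicit Arguments.
Unset Strict Implicit.

(** * One-variable calculus *)

(** The derivative relative to [I] as a first-order estimate, valid at interior
    points and at endpoints alike. *)
Lemma deriv_within_estimate (R : realType) (I : set R) (f : R -> R) (t d e : R) :
  deriv_within I f t d -> 0 < e ->
  exists2 del, 0 < del & forall r, I r -> `|r - t| < del ->
    `|f r - f t - d * (r - t)| <= e * `|r - t|.
Proof.
move=> /cvgrPdist_le dfd e0.
have [del /= del0 H] := dfd e e0.
exists del => // r Ir rt.
have [->|rnt] := eqVneq r t; first by rewrite !subrr mulr0 subrr normr0 mulr0.
have rt0 : r - t != 0 by rewrite subr_eq0.
have := H r; rewrite /ball /= distrC => /(_ rt rnt Ir) H1.
rewrite -[X in X - _ * _](divfK rt0) -mulrBl normrM distrC.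
by rewrite ler_wpM2r.
Qed.

Lemma deriv_within_continuous (R : realType) (I : set R) (f : R -> R) (t d e : R) :
  deriv_within I f t d -> 0 < e ->
  exists2 del, 0 < del & forall r, I r -> `|r - t| < del -> `|f r - f t| < e.
Proof.
move=> dfd e0.
have [del del0 H] := deriv_within_estimate dfd ltr01.
have d1 : 0 < `|d| + 1 by rewrite ltr_wpDl.
exists (Num.min del (e / (`|d| + 1))); first by rewrite lt_min del0 divr_gt0.
move=> r Ir; rewrite lt_min => /andP[rd re].
have := H r Ir rd; rewrite mul1r => H1.
have -> : f r - f t = (f r - f t - d * (r - t)) + d * (r - t) by ring.
apply: le_lt_trans (ler_normD _ _) _; rewrite normrM.
apply: le_lt_trans (_ : (`|d| + 1) * `|r - t| < _).
  by rewrite mulrDl mul1r addrC lerD2l.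
by rewrite mulrC -ltr_pdivlMr.
Qed.

Lemma deriv_within_interior (R : realType) (I : set R) (f : R -> R) (t d : R) :
  nbhs t I -> deriv_within I f t d -> is_derive t 1 f d.
Proof.
move=> It dfd.
suff H : h^-1 *: (f (h *: 1 + t) - f t) @[h --> 0^'] --> d.
  by split; [apply/cvg_ex; exists d|apply/cvg_lim].
apply/cvgrPdist_le => e e0.
have [del del0 H] := deriv_within_estimate dfd e0.
have /nbhs_ballP[rho /= rho0 HI] := It.
near=> h.
have h0 : h != 0 by near: h; exact: nbhs_dnbhs_neq.
have hs : `|h| < Num.min del rho.
  near: h; apply: dnbhs0_lt.
  by rewrite lt_min del0.
move: hs; rewrite lt_min => /andP[hd hr].
have E : h *: (1 : R) + t = h + t by rewrite [_ *: _]mulr1.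
rewrite E.
have Ih : I (h + t).
  by apply: HI; rewrite /ball /= opprD addrCA subrr addr0 normrN.
have := H _ Ih; rewrite addrK => /(_ hd) H1.
rewrite [_ *: _](mulrC h^-1) distrC.
have -> : (f (h + t) - f t) / h - d = (f (h + t) - f t - d * h) / h by field.
by rewrite normrM normfV ler_pdivrMr ?normr_gt0.
Unshelve. all: by end_near. Qed.

(** Mean value theorem under derivability on the closed interval. *)
Lemma MVT_derive (R : realType) (f df : R -> R) (a b : R) : a < b ->
  (forall x, a <= x <= b -> is_derive x 1 f (df x)) ->
  exists2 c, a < c < b & f b - f a = df c * (b - a).
Proof.
move=> ab H.
have H1 x : x \in `]a, b[ -> is_derive x 1 f (df x).
  by rewrite in_itv/= => /andP[xa xb]; apply: H; rewrite !ltW.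
have H2 : {within `[a, b], continuous f}.
  apply: derivable_within_continuous => x; rewrite in_itv/= => /H h.
  exact: ex_derive.
by have [c] := MVT ab H1 H2; rewrite in_itv/= => cab E; exists c.
Qed.

Lemma nonincreasing_derive (R : realType) (f df : R -> R) (a b : R) : a <= b ->
  (forall x, a <= x <= b -> is_derive x 1 f (df x)) ->
  (forall x, a <= x <= b -> df x <= 0) -> f b <= f a.
Proof.
rewrite le_eqVlt => /predU1P[->//|ab] H H0.
have [c /andP[ac cb] E] := MVT_derive ab H.
by rewrite -subr_le0 E mulr_le0_ge0 ?H0 ?subr_ge0 ?ltW.
Qed.

Lemma derive_locally_constant (R : realType) (f : R -> R) (a b c t d : R) :
  a < t < b -> (forall r, a < r < b -> f r = c) -> is_derive t 1 f d -> d = 0.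
Proof.
move=> /andP[at_ tb] H fd.
have : is_derive t 1 f 0.
  apply: (@near_eq_is_derive _ _ _ (cst c)).
  near=> r; rewrite H//; apply/andP; split; near: r.
    exact: lt_nbhsr.
  exact: lt_nbhsl.
move=> f0; rewrite -(@derive_val _ _ _ _ _ _ _ f0).
by rewrite (@derive_val _ _ _ _ _ _ _ fd).
Unshelve. all: by end_near. Qed.

(** A second-order homogeneous differential inequality has no nontrivial
    solution vanishing to first order at one end: [(v^2 + v1^2) exp(C t)] is
    monotone for a suitable [C]. *)
Lemma gronwall_left (R : realType) (v v1 v2 : R -> R) (a b K : R) :
  a <= b -> 0 <= K ->
  (forall x, a <= x <= b -> is_derive x 1 v (v1 x)) ->
  (forall x, a <= x <= b -> is_derive x 1 v1 (v2 x)) ->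
  (forall x, a <= x <= b -> `|v2 x| <= K * (`|v x| + `|v1 x|)) ->
  v b = 0 -> v1 b = 0 -> v a = 0.
Proof.
move=> ab K0 Dv Dv1 Hv2 vb v1b.
pose C := 1 + 3 * K.
pose h x := - ((v x ^+ 2 + v1 x ^+ 2) * expR (C * x)).
pose dh x := - ((2 * v x * v1 x + 2 * v1 x * v2 x + C * (v x ^+ 2 + v1 x ^+ 2))
                * expR (C * x)).
have Dh x : a <= x <= b -> is_derive x 1 h (dh x).
  move=> xab; have D1 := Dv x xab; have D2 := Dv1 x xab.
  have D3 : is_derive x 1 (fun x => expR (C * x)) (expR (C * x) * C).
    apply: (@is_derive1_comp _ expR (fun x => C * x)).
    have D0 := @is_deriveZ R R R id C x 1 1 (is_derive_id x 1).
    by apply: is_derive_eq D0 _; rewrite [_ *: _]mulr1.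
  pose D4 := is_deriveN (is_deriveM (is_deriveD (is_deriveX 2 D1) (is_deriveX 2 D2)) D3).
  apply: is_derive_eq D4 _.
  by rewrite /dh /GRing.scale /= !fctE /=; ring.
have h_le : h b <= h a.
  apply: (nonincreasing_derive (df := dh)) => // x xab.
  rewrite oppr_le0 mulr_ge0 ?expR_ge0//.
  have := Hv2 x xab => H2.
  have A1 : `|v x * v1 x| * 2 <= v x ^+ 2 + v1 x ^+ 2.
    rewrite normrM -(real_normK (num_real (v x))) -(real_normK (num_real (v1 x))).
    have := sqr_ge0 (`|v x| - `|v1 x|); nra.
  have A2 : `|v1 x * v2 x| <= `|v1 x| * (K * (`|v x| + `|v1 x|)).
    by rewrite normrM ler_wpM2l.
  have A3 : `|v1 x| ^+ 2 = v1 x ^+ 2 by rewrite real_normK ?num_real.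
  have A4 : `|v x * v1 x| = `|v x| * `|v1 x| by rewrite normrM.
  have B1 : - `|v x * v1 x| <= v x * v1 x by rewrite lerNl ler_normr lexx orbT.
  have B2 : - `|v1 x * v2 x| <= v1 x * v2 x by rewrite lerNl ler_normr lexx orbT.
  have B3 : K * (`|v x * v1 x| * 2) <= K * (v x ^+ 2 + v1 x ^+ 2) by rewrite ler_wpM2l.
  have B4 : K * v1 x ^+ 2 <= K * (v x ^+ 2 + v1 x ^+ 2).
    by rewrite ler_wpM2l// lerDr sqr_ge0.
  have A5 : `|v1 x| * (K * (`|v x| + `|v1 x|)) =
      K * (`|v x| * `|v1 x|) + K * v1 x ^+ 2 by rewrite -A3; ring.
  rewrite A5 in A2; rewrite A4 in A1 B1 B3.
  rewrite /C; lra.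
have : v a ^+ 2 + v1 a ^+ 2 <= 0.
  move: h_le; rewrite /h vb v1b expr0n/= addr0 mul0r oppr0 oppr_ge0.
  by rewrite pmulr_lle0 ?expR_gt0.
move=> H; apply/eqP; rewrite -sqrf_eq0 eq_le sqr_ge0 andbT.
by apply: le_trans H; rewrite lerDl sqr_ge0.
Qed.

Lemma is_derive_opp_arg (R : realType) (f : R -> R) (x d : R) :
  is_derive (- x) 1 f d -> is_derive x 1 (fun y => f (- y)) (- d).
Proof.
move=> D; have -> : - d = d * (- 1) by rewrite mulrN1.
exact: (@is_derive1_comp _ f -%R).
Qed.

Lemma gronwall_right (R : realType) (v v1 v2 : R -> R) (a b K : R) :
  a <= b -> 0 <= K ->
  (forall x, a <= x <= b -> is_derive x 1 v (v1 x)) ->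
  (forall x, a <= x <= b -> is_derive x 1 v1 (v2 x)) ->
  (forall x, a <= x <= b -> `|v2 x| <= K * (`|v x| + `|v1 x|)) ->
  v a = 0 -> v1 a = 0 -> v b = 0.
Proof.
move=> ab K0 Dv Dv1 Hv2 va v1a.
have flip x : - b <= x <= - a -> a <= - x <= b.
  by move=> /andP[bx xa]; rewrite lerNr xa lerNl bx.
rewrite -[b]opprK.
apply: (@gronwall_left _ (fun x => v (- x)) (fun x => - v1 (- x))
          (fun x => v2 (- x)) (- b) (- a) K) => //.
- by rewrite lerN2.
- by move=> x /flip xab; apply: is_derive_opp_arg; apply: Dv.
- move=> x /flip xab; rewrite -[v2 _]opprK.
  have D := is_derive_opp_arg (Dv1 _ xab).
  exact: (@is_deriveN _ _ _ (fun y => v1 (- y)) x 1 _ D).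
- by move=> x /flip xab; rewrite normrN; apply: Hv2.
- by rewrite opprK.
- by rewrite opprK v1a oppr0.
Qed.

(** The potential [|y|^(p+1)] is differentiable, also at [0]. *)
Lemma is_derive_powR_abs (R : realType) (p x : R) : 1 < p ->
  is_derive x 1 (fun y : R => `|y| `^ (p + 1)) ((p + 1) * (`|x| `^ (p - 1) * x)).
Proof.
move=> p1.
have p0 : 0 < p by apply: lt_trans p1.
have E y : 0 < y -> y `^ (p - 1) * y = y `^ p.
  move=> y0; rewrite -{2}[y]powRr1 ?ltW// -powRD ?subrK//.
  by rewrite gt_eqF// ?implybT.
have [x0|x0|->] := ltgtP x 0.
- apply: (@near_eq_is_derive _ _ _ (fun y => (- y) `^ (p + 1))).
    by near=> y; rewrite ltr0_norm//; near: y; exact: lt_nbhsl.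
  have -> : (p + 1) * (`|x| `^ (p - 1) * x) = - ((p + 1) * (- x) `^ (p + 1 - 1)).
    by rewrite addrK ltr0_norm// -(E (- x)) ?oppr_gt0// !mulrN opprK.
  apply: (is_derive_opp_arg (f := fun y => y `^ (p + 1))).
  by apply: is_derive1_powR; rewrite oppr_gt0.
- apply: (@near_eq_is_derive _ _ _ (fun y => y `^ (p + 1))).
    by near=> y; rewrite gtr0_norm//; near: y; exact: lt_nbhsr.
  by have := @is_derive1_powR R (p + 1) x x0; rewrite addrK gtr0_norm// E.
rewrite !mulr0.
suff H : (fun h : R => h^-1 *: (`|h *: (1 : R) + 0| `^ (p + 1) - `|0 : R| `^ (p + 1))) @ 0^' --> (0 : R).
  by split; [apply/cvg_ex; exists 0|apply/cvg_lim].
apply/cvgrPdist_le => e e0.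
have e1 : 0 < e `^ p^-1 by apply: powR_gt0.
near=> h.
have h0 : h != 0 by near: h; exact: nbhs_dnbhs_neq.
have hs : `|h| < e `^ p^-1.
  by near: h; exact: dnbhs0_lt.
rewrite normr0 powR0 ?gt_eqF ?addr_gt0// subr0 addr0 sub0r normrN.
rewrite [h *: _]mulr1 normrM normfV.
rewrite powRD ?normr_eq0 ?h0 ?implybT// powRr1// normrM normr_id mulrC mulfK ?normr_eq0//.
rewrite ger0_norm ?powR_ge0//.
have -> : e = (e `^ p^-1) `^ p by rewrite -powRrM mulVf ?gt_eqF// powRr1 ?ltW.
by rewrite ge0_ler_powR ?ltW// nnegrE ltW.
Unshelve. all: by end_near. Qed.
(** * Connected components *)

(** A set of reals containing no nondegenerate segment. *)
Definition interval_free (R : realType) (Z : set R) : Prop :=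
  forall a b, a < b -> ~ (forall t, a <= t <= b -> Z t).

(** A connected set on which [f] takes its values in an interval-free set lies
    in a single fibre of [f]. *)
Lemma component_in_fibre (R : realType) (T : topologicalType) (f : T -> R)
    (Z : set R) (D : set T) (z : T) :
  continuous f -> interval_free Z -> (forall w, D w -> Z (f w)) -> D z ->
  connected_component D z = connected_component (D `&` [set w | f w = f z]) z.
Proof.
move=> cf iZ DZ Dz; apply/seteqP; split.
  apply: connected_component_max; last exact: component_connected.
    exact: connected_component_refl.
  move=> w Cw; split; first exact: connected_component_sub Cw.
  have /connected_intervalP IC : connected (f @` connected_component D z).
    apply: connected_continuous_connected; first exact: component_connected.
    exact: continuous_subspaceT.
  have inC x y t : connected_component D z x -> connected_component D z y ->
      f x <= t <= f y -> Z t.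
    move=> Cx Cy txy.
    have [v Cv <-] : (f @` connected_component D z) t.
      by apply: (IC (f x) (f y)).
    exact/DZ/(connected_component_sub Cv).
  have Cz := connected_component_refl Dz.
  apply/eqP; apply/negPn/negP; rewrite neq_lt => /orP[l|l].
    by case: (iZ _ _ l) => t; apply: inC.
  by case: (iZ _ _ l) => t; apply: inC.
apply: connected_component_max; last exact: component_connected.
  exact: connected_component_refl.
by move=> w /connected_component_sub[].
Qed.

Lemma path_component (R : realType) (T : topologicalType) (A : set T)
    (z w : T) (g : R -> T) :
  (forall t, 0 <= t <= 1 -> {for t, continuous g}) -> g 0 = z -> g 1 = w ->
  (forall t, 0 <= t <= 1 -> A (g t)) -> connected_component A z w.
Proof.
move=> cg g0 g1 gA.
have Cg : connected (g @` `[0, 1]%classic).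
  apply: connected_continuous_connected.
    by apply/connected_intervalP; exact: interval_is_interval.
  apply: continuous_in_subspaceT => t.
  by rewrite inE /= in_itv /= => /cg.
have sub : g @` `[0, 1]%classic `<=` A.
  by move=> _ [t + <-]; rewrite /= in_itv /= => /gA.
have z0 : (g @` `[0, 1]%classic) z by exists 0; rewrite //= in_itv/= lexx ler01.
have w0 : (g @` `[0, 1]%classic) w by exists 1; rewrite //= in_itv/= lexx ler01.
exact: (connected_component_max z0 sub Cg).
Qed.

Lemma component_full (T : topologicalType) (A : set T) (z : T) :
  (forall w, A w -> connected_component A z w) -> connected_component A z = A.
Proof.
by move=> H; apply/seteqP; split => [|w /H//]; exact: connected_component_sub.
Qed.

(** A set any two points of which lie in a common component is its own component. *)
Lemma component_fullT (T : topologicalType) (A : set T) (z : T) :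
  (forall x y, A x -> A y -> connected_component A x y) -> A z ->
  connected_component A z = A.
Proof. by move=> H Az; apply: component_full => w; apply: H. Qed.

Lemma continuous_scalel (R : realType) (V : normedModType R) (T : topologicalType)
    (f : T -> R) (v : V) (t : T) :
  {for t, continuous f} -> {for t, continuous (fun t => f t *: v)}.
Proof. by move=> cf; apply: cvgZ; [exact: cf | exact: cvg_cst]. Qed.

(** * Coordinates *)

Lemma tcE (R : realType) (m : nat) (z : 'rV[R]_m) (i : 'I_m) : tc z i = z 0 i.
Proof. by rewrite /tc valK. Qed.

Lemma tc_out (R : realType) (m : nat) (z : 'rV[R]_m) i : (m <= i)%N -> tc z i = 0.
Proof. by move=> mi; rewrite /tc insubN// -leqNgt. Qed.

Lemma tcD (R : realType) (m : nat) (z w : 'rV[R]_m) i :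
  tc (z + w) i = tc z i + tc w i.
Proof. by rewrite /tc; case: insub => [j|] /=; rewrite ?mxE ?addr0. Qed.

Lemma tcZ (R : realType) (m : nat) (c : R) (z : 'rV[R]_m) i :
  tc (c *: z) i = c * tc z i.
Proof. by rewrite /tc; case: insub => [j|] /=; rewrite ?mxE ?mulr0. Qed.

Lemma tc0 (R : realType) (m : nat) i : tc (0 : 'rV[R]_m) i = 0.
Proof. by rewrite -[X in tc X _](scale0r 0) tcZ mul0r. Qed.

Lemma tc_delta (R : realType) (m : nat) (j : 'I_m) (i : nat) :
  tc (delta_mx 0 j : 'rV[R]_m) i = (i == j)%:R.
Proof.
have [im|mi] := ltnP i m.
  by rewrite (tcE _ (Ordinal im)) mxE eqxx.
rewrite tc_out//; case: eqP => // ij.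
by move: mi; rewrite ij leqNgt ltn_ord.
Qed.

Lemma tc_continuous (R : realType) (m : nat) (i : nat) :
  continuous (fun z : 'rV[R]_m => tc z i).
Proof.
have [im|mi] := ltnP i m.
  have -> : (fun z : 'rV[R]_m => tc z i) = fun z => z 0 (Ordinal im).
    by apply/funext => z; rewrite (tcE _ (Ordinal im)).
  exact: coord_continuous.
have -> : (fun z : 'rV[R]_m => tc z i) = cst 0.
  by apply/funext => z; rewrite tc_out.
exact: cst_continuous.
Qed.

Lemma sum_continuous (R : realType) (T : topologicalType) (I : Type) (r : seq I)
    (P : pred I) (f : I -> T -> R) :
  (forall i, P i -> continuous (f i)) ->
  continuous (fun z => \sum_(i <- r | P i) f i z).
Proof.
move=> H; elim: r => [|i r IH] z.
  rewrite (_ : (fun z => _) = cst 0); first exact: cvg_cst.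
  by apply/funext => w; rewrite big_nil.
rewrite (_ : (fun z => _) = fun z => (if P i then f i z else 0) +
    \sum_(j <- r | P j) f j z).
  apply: continuousD; last exact: IH.
  by case Pi: (P i); [exact: H | exact: cvg_cst].
by apply/funext => w; rewrite big_cons; case: ifP; rewrite ?add0r.
Qed.

(** The scalar product as a single signed sum over the coordinates. *)
Lemma mink_sum (R : realType) (m s : nat) (z w : 'rV[R]_m) : (s <= m)%N ->
  mink s z w = \sum_(i < m) (-1) ^+ (i < s)%N * (z 0 i * w 0 i).
Proof.
move=> sm; rewrite /mink.
under [RHS]eq_bigr do rewrite -!tcE.
rewrite -(big_mkord xpredT (fun i => (-1) ^+ (i < s)%N * (tc z i * tc w i))).
rewrite (big_cat_nat (n := s))//=; congr +%R.
  rewrite -sumrN big_mkord; apply: eq_bigr => i _.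
  by rewrite ltn_ord expr1 mulN1r.
rewrite -[in RHS](add0n s) big_addn big_mkord; apply: eq_bigr => i _.
by rewrite /xc addnC ltnNge leq_addl expr0 mul1r.
Qed.

(** The sum of the squares of the coordinates with index in [P]. *)
Definition sqnorm_on (R : realType) (m : nat) (P : {set 'I_m}) (z : 'rV[R]_m) : R :=
  \sum_(i in P) z 0 i ^+ 2.

(** The indices of [t_1, ..., t_k] and of [x_1, ..., x_n]. *)
Definition t_indices (m k : nat) : {set 'I_m} := [set i : 'I_m | (i < k)%N].
Definition x_indices (m s n : nat) : {set 'I_m} :=
  [set i : 'I_m | (s <= i < s + n)%N].

Lemma sqnorm_t (R : realType) (m k : nat) (z : 'rV[R]_m) : (k <= m)%N ->
  \sum_(i < k) tc z i ^+ 2 = sqnorm_on (t_indices m k) z.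
Proof.
move=> km; rewrite (big_ord_widen _ (fun i => tc z i ^+ 2) km) /sqnorm_on.
by apply: eq_big => [i|i _]; rewrite ?inE// tcE.
Qed.

Lemma sqnorm_x (R : realType) (m s n : nat) (z : 'rV[R]_m) : (s + n <= m)%N ->
  \sum_(j < n) xc s z j ^+ 2 = sqnorm_on (x_indices m s n) z.
Proof.
move=> snm; rewrite /sqnorm_on.
under [RHS]eq_bigr do rewrite -tcE.
transitivity (\sum_(0 <= i < m | (s <= i < s + n)%N) tc z i ^+ 2); last first.
  by rewrite big_mkord; apply: eq_bigl => i; rewrite inE.
rewrite (big_cat_nat (n := s)) ?(leq_trans (leq_addr n s))//=.
rewrite [X in _ = X + _]big_nat_cond [X in _ = X + _]big_pred0 ?add0r; last first.
  by move=> i; apply/negbTE/negP => /andP[/andP[_ +] /andP[+ _]]; rewrite ltnNge => /negP.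
rewrite (big_cat_nat (n := s + n)) ?leq_addr//=.
rewrite [X in _ = _ + X]big_nat_cond [X in _ = _ + X]big_pred0 ?addr0; last first.
  by move=> i; apply/negbTE/negP => /andP[/andP[+ _] /andP[_ +]]; rewrite ltnNge => + /negP.
rewrite -[X in \sum_(X <= _ < _ | _) _](add0n s) big_addn addKn big_mkord.
apply: eq_big => [i|i _]; last by rewrite /xc addnC.
by rewrite leq_addl addnC ltn_add2l ltn_ord.
Qed.

Lemma ellE (R : realType) (m s k n : nat) (z : 'rV[R]_m) :
  (k <= m)%N -> (s + n <= m)%N ->
  ell s k n z = - sqnorm_on (t_indices m k) z + sqnorm_on (x_indices m s n) z.
Proof. by move=> km snm; rewrite /ell sqnorm_t// sqnorm_x. Qed.

Lemma sqnorm_on_ge0 (R : realType) (m : nat) (P : {set 'I_m}) (z : 'rV[R]_m) :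
  0 <= sqnorm_on P z.
Proof. by apply: sumr_ge0 => i _; exact: sqr_ge0. Qed.

Lemma sqnorm_on_eq0 (R : realType) (m : nat) (P : {set 'I_m}) (z : 'rV[R]_m) :
  sqnorm_on P z = 0 <-> forall i, i \in P -> z 0 i = 0.
Proof.
split=> [/eqP|H]; last by apply: big1 => i /H ->; rewrite expr0n.
rewrite psumr_eq0; last by move=> i _; exact: sqr_ge0.
move=> /allP H i iP; have := H i (mem_index_enum i).
by rewrite iP/= sqrf_eq0 => /eqP.
Qed.

Lemma sqnorm_onZ (R : realType) (m : nat) (P : {set 'I_m}) (c : R) (z : 'rV[R]_m) :
  sqnorm_on P (c *: z) = c ^+ 2 * sqnorm_on P z.
Proof. by rewrite /sqnorm_on mulr_sumr; apply: eq_bigr => i _; rewrite mxE exprMn. Qed.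

Lemma sqnorm_on0 (R : realType) (m : nat) (P : {set 'I_m}) :
  sqnorm_on P (0 : 'rV[R]_m) = 0.
Proof. by apply/sqnorm_on_eq0 => i _; rewrite mxE. Qed.

Lemma sqnorm_onN (R : realType) (m : nat) (P : {set 'I_m}) (z : 'rV[R]_m) :
  sqnorm_on P (- z) = sqnorm_on P z.
Proof. by rewrite -scaleN1r sqnorm_onZ sqrrN expr1n mul1r. Qed.

Lemma sqnorm_on_line (R : realType) (m : nat) (P : {set 'I_m}) (z w : 'rV[R]_m)
    (h : R) :
  sqnorm_on P (h *: w + z) = sqnorm_on P z
    + h * (2 * \sum_(i in P) z 0 i * w 0 i) + h ^+ 2 * sqnorm_on P w.
Proof.
rewrite /sqnorm_on !mulr_sumr -!big_split /=.
by apply: eq_bigr => i _; rewrite !mxE; ring.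
Qed.

Lemma sqnorm_on_delta (R : realType) (m : nat) (P : {set 'I_m}) (j : 'I_m) :
  sqnorm_on P (delta_mx 0 j : 'rV[R]_m) = (j \in P)%:R.
Proof.
rewrite /sqnorm_on; have [jP|jP] := boolP (j \in P).
  rewrite (bigD1 j)//= big1 ?addr0 => [|i /andP[_ ij]].
    by rewrite mxE !eqxx expr1n.
  by rewrite mxE (negbTE ij) andbF expr0n.
apply: big1 => i iP; rewrite mxE andTb; case: eqP => [ij|_]; last by rewrite expr0n.
by rewrite -ij iP in jP.
Qed.

Lemma sum_delta (R : realType) (m : nat) (P : {set 'I_m}) (z : 'rV[R]_m) (j : 'I_m) :
  \sum_(i in P) z 0 i * (delta_mx 0 j : 'rV_m) 0 i = (j \in P)%:R * z 0 j.
Proof.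
have [jP|jP] := boolP (j \in P).
  rewrite (bigD1 j)//= big1 ?addr0 => [|i /andP[_ ij]].
    by rewrite mxE !eqxx mulr1 mul1r.
  by rewrite mxE (negbTE ij) andbF mulr0.
rewrite mul0r; apply: big1 => i iP; rewrite mxE andTb; case: eqP => [ij|_]; last by rewrite mulr0.
by rewrite -ij iP in jP.
Qed.

Lemma sqnorm_on_continuous (R : realType) (m : nat) (P : {set 'I_m}) :
  continuous (@sqnorm_on R m P).
Proof.
apply: sum_continuous => i _ z.
by apply: continuousM; exact: coord_continuous.
Qed.

Lemma tc_coord_proj (R : realType) (m s k n : nat) (z : 'rV[R]_m) i :
  (i < k + n)%N ->
  tc (coord_proj s k n z) i = if (i < k)%N then tc z i else xc s z (i - k).
Proof.
move=> ikn; rewrite (tcE _ (Ordinal ikn)) /coord_proj.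
case: ltnP => ik.
  rewrite (_ : Ordinal ikn = lshift n (Ordinal ik)); last exact: val_inj.
  by rewrite row_mxEl mxE.
have ik' : (i - k < n)%N by rewrite ltn_subLR.
rewrite (_ : Ordinal ikn = rshift k (Ordinal ik')).
  by rewrite row_mxEr mxE.
by apply: val_inj => /=; rewrite subnKC.
Qed.

(** The quadratic form of each quadric factor, in the coordinates of the
    ambient space. *)
Lemma mink_coord_proj (R : realType) (m s k n : nat) (z : 'rV[R]_m) :
  mink k (coord_proj s k n z) (coord_proj s k n z) = ell s k n z.
Proof.
rewrite /mink /ell addKn; congr (- _ + _).
  apply: eq_bigr => i _.
  by rewrite tc_coord_proj ?ltn_ord ?expr2// ltn_addr.
apply: eq_bigr => j _.
by rewrite /xc tc_coord_proj ?ltn_add2l// ltnNge leq_addr/= addKn expr2.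
Qed.

Lemma mink0_coord_proj_x (R : realType) (m s n : nat) (z : 'rV[R]_m) :
  mink 0 (coord_proj s 0 n z) (coord_proj s 0 n z) = \sum_(j < n) xc s z j ^+ 2.
Proof. by rewrite mink_coord_proj /ell big_ord0 oppr0 add0r. Qed.

Lemma mink0_coord_proj_t (R : realType) (m s k : nat) (z : 'rV[R]_m) :
  mink 0 (coord_proj s k 0 z) (coord_proj s k 0 z) = \sum_(i < k) tc z i ^+ 2.
Proof.
rewrite /mink big_ord0 oppr0 add0r.
transitivity (\sum_(i < k + 0 - 0) tc z i ^+ 2); last by rewrite subn0 addn0.
apply: eq_bigr => i _.
have ik : (i < k + 0)%N := leq_trans (ltn_ord i) (leq_subr 0 _).
have ik' : (i < k)%N by rewrite -[X in (_ < X)%N](addn0 k).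
by rewrite /xc add0n tc_coord_proj// ik' expr2.
Qed.
(** * Isometries and homotheties *)

Lemma minkC (R : realType) (m s : nat) (z w : 'rV[R]_m) : mink s z w = mink s w z.
Proof.
by rewrite /mink; congr (- _ + _); apply: eq_bigr => i _; rewrite mulrC.
Qed.

Lemma minkDl (R : realType) (m s : nat) (z w y : 'rV[R]_m) :
  mink s (z + w) y = mink s z y + mink s w y.
Proof.
rewrite /mink /xc; under eq_bigr do rewrite tcD mulrDl.
under [X in _ + X = _]eq_bigr do rewrite tcD mulrDl.
by rewrite !big_split/=; ring.
Qed.

Lemma minkZl (R : realType) (m s : nat) (c : R) (z y : 'rV[R]_m) :
  mink s (c *: z) y = c * mink s z y.
Proof.
rewrite /mink /xc; under eq_bigr do rewrite tcZ -mulrA.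
under [X in _ + X = _]eq_bigr do rewrite tcZ -mulrA.
by rewrite -!mulr_sumr; ring.
Qed.

Lemma minkNl (R : realType) (m s : nat) (z y : 'rV[R]_m) :
  mink s (- z) y = - mink s z y.
Proof. by rewrite -scaleN1r minkZl mulN1r. Qed.

Lemma minkDr (R : realType) (m s : nat) (z w y : 'rV[R]_m) :
  mink s y (z + w) = mink s y z + mink s y w.
Proof. by rewrite minkC minkDl !(minkC _ y). Qed.

Lemma minkZr (R : realType) (m s : nat) (c : R) (z y : 'rV[R]_m) :
  mink s y (c *: z) = c * mink s y z.
Proof. by rewrite minkC minkZl minkC. Qed.

Lemma minkNr (R : realType) (m s : nat) (z y : 'rV[R]_m) :
  mink s y (- z) = - mink s y z.
Proof. by rewrite minkC minkNl minkC. Qed.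

Lemma mink_delta (R : realType) (m s : nat) (z : 'rV[R]_m) (j : 'I_m) :
  (s <= m)%N -> mink s z (delta_mx 0 j) = (-1) ^+ (j < s)%N * z 0 j.
Proof.
move=> sm; rewrite mink_sum// (bigD1 j)//= big1 ?addr0.
  by rewrite mxE !eqxx mulr1.
by move=> i ij; rewrite mxE (negbTE ij) andbF !mulr0.
Qed.

Lemma mink_nondegenerate (R : realType) (m s : nat) (z : 'rV[R]_m) : (s <= m)%N ->
  (forall y, mink s z y = 0) -> z = 0.
Proof.
move=> sm H; apply/rowP => j; rewrite mxE.
have /eqP := H (delta_mx 0 j); rewrite mink_delta// mulf_eq0 signr_eq0.
by move=> /eqP.
Qed.

(** A bijection preserving an indefinite distance is affine: its linear part
    preserves the scalar product by polarization, and additivity follows from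
    nondegeneracy. *)
Lemma isometry_linear (R : realType) (m s : nat) (g : 'rV[R]_m -> 'rV[R]_m) :
  (s <= m)%N -> Defs.isometry s g ->
  (forall z w, mink s (g z - g 0) (g w - g 0) = mink s z w) /\
  (forall a z w, g (a *: z + w) - g 0 = a *: (g z - g 0) + (g w - g 0)).
Proof.
move=> sm [[g' gK g'K] H].
have inner z w : mink s (g z - g 0) (g w - g 0) = mink s z w.
  have := H z w; have := H z 0; have := H w 0; rewrite !subr0.
  have -> : g z - g w = (g z - g 0) - (g w - g 0) by rewrite opprB addrA subrK.
  move: (g z - g 0) (g w - g 0) => x y.
  rewrite !(minkDl, minkDr, minkNl, minkNr) (minkC s y x) (minkC s w z).
  by move=> -> ->; lra.
split=> // a z w; apply/eqP; rewrite -subr_eq0; apply/eqP.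
apply: (mink_nondegenerate sm) => y.
have -> : y = g (g' (y + g 0)) - g 0 by rewrite g'K addrK.
have [F FE] : exists F, forall z, g z - g 0 = F z by exists (fun z => g z - g 0).
have innerF u v : mink s (F u) (F v) = mink s u v by rewrite -!FE inner.
by rewrite !FE !(minkDl, minkNl, minkZl) !innerF !(minkDl, minkZl); ring.
Qed.

Lemma isometry_shift (R : realType) (m s : nat) (b : 'rV[R]_m) :
  Defs.isometry s (fun z => z + b).
Proof.
split; first by exists (fun z => z - b) => z; rewrite ?addrK ?subrK.
by move=> z w; rewrite opprD addrACA subrr addr0.
Qed.

Lemma homothetic_scale (R : realType) (m s : nat) (c : R) (S M : set 'rV[R]_m) :
  0 < c -> (forall z, S (c *: z) <-> M z) -> homothetic s S M.
Proof.
move=> c0 H; exists id, c; split=> //.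
  by split=> //; exists id.
apply/seteqP; split=> [z Sz|_ [z Mz <-]]; last exact/H.
exists (c^-1 *: z); last by rewrite scalerA divff ?gt_eqF// scale1r.
by apply/H; rewrite scalerA divff ?gt_eqF// scale1r.
Qed.

Lemma homothetic_shift (R : realType) (m s : nat) (b : 'rV[R]_m)
    (S M : set 'rV[R]_m) :
  (forall z, S (z + b) <-> M z) -> homothetic s S M.
Proof.
move=> H; exists (fun z => z + b), 1; split=> //; first exact: isometry_shift.
apply/seteqP; split=> [z Sz|_ [z Mz <-]]; last by rewrite scale1r; exact/H.
by exists (z - b); [apply/H; rewrite subrK|rewrite scale1r subrK].
Qed.

Lemma homothetic_refl (R : realType) (m s : nat) (S : set 'rV[R]_m) :
  homothetic s S S.
Proof. by apply: (@homothetic_scale _ _ _ 1) => // z; rewrite scale1r. Qed.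

Lemma homothetic_sym (R : realType) (m s : nat) (S M : set 'rV[R]_m) :
  homothetic s S M -> homothetic s M S.
Proof.
move=> [g [c [[[g' gK g'K] H] c0 ->]]].
have cN0 : c != 0 by rewrite gt_eqF.
have cV (z : 'rV[R]_m) : c^-1 *: (c *: z) = z by rewrite scalerA mulVf// scale1r.
have cK (z : 'rV[R]_m) : c *: (c^-1 *: z) = z by rewrite scalerA divff// scale1r.
exists (fun z => c^-1 *: g' (c *: z)), c^-1; split; rewrite ?invr_gt0//; last first.
  apply/seteqP; split=> [z Mz|_ [_ [y My <-] <-]].
    by exists (g (c *: z)); [exists z|rewrite cK gK cV].
  by rewrite cK gK cV.
split.
  exists (fun z => c^-1 *: g (c *: z)) => z.
    by rewrite cK g'K cV.
  by rewrite cK gK cV.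
move=> z w; have := H (g' (c *: z)) (g' (c *: w)).
rewrite !g'K -!scalerBr !(minkZl, minkZr) => <-.
by field.
Qed.

Lemma homothetic_trans (R : realType) (m s : nat) (S M N : set 'rV[R]_m) :
  homothetic s S M -> homothetic s M N -> homothetic s S N.
Proof.
move=> [g [c [[[g' gK g'K] H] c0 ->]]] [f [d [[[f' fK f'K] F] d0 ->]]].
have cN0 : c != 0 by rewrite gt_eqF.
have cV (z : 'rV[R]_m) : c^-1 *: (c *: z) = z by rewrite scalerA mulVf// scale1r.
have cK (z : 'rV[R]_m) : c *: (c^-1 *: z) = z by rewrite scalerA divff// scale1r.
exists (fun z => g (c *: f (c^-1 *: z))), (c * d); split; rewrite ?mulr_gt0//.
  split.
    exists (fun z => c *: f' (c^-1 *: g' z)) => z.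
      by rewrite gK cV fK cK.
    by rewrite cV f'K cK g'K.
  move=> z w; rewrite H -scalerBr minkZl minkZr F -scalerBr minkZl minkZr.
  by field.
apply/seteqP; split=> [_ [_ [z Nz <-] <-]|_ [z Nz <-]].
  by exists z => //; rewrite -scalerA cV.
by exists (f (d *: z)); [exists z|rewrite -scalerA cV].
Qed.

Lemma homothetic_affine (R : realType) (m s : nat) (S M : set 'rV[R]_m) :
  (s <= m)%N -> homothetic s S M ->
  exists G : 'rV[R]_m -> 'rV[R]_m,
    [/\ injective G, S = [set G z | z in M] &
        forall a z w, G (a *: z + (1 - a) *: w) = a *: G z + (1 - a) *: G w].
Proof.
move=> sm [g [c [ig c0 ->]]].
have [_ lin] := isometry_linear sm ig.
case: ig => [[g' gK g'K] _].
exists (fun z => g (c *: z)); split=> //.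
  by move=> z w /(can_inj gK) /(scalerI (lt0r_neq0 c0)).
move=> a z w.
have L1 x y : g (a *: x + y) = a *: (g x - g 0) + (g y - g 0) + g 0.
  by rewrite -lin subrK.
have L2 y : g ((1 - a) *: y) = (1 - a) *: (g y - g 0) + g 0.
  by have := lin (1 - a) y 0; rewrite addr0 subrr addr0 => <-; rewrite subrK.
rewrite scalerDr !scalerA ![c * _]mulrC -!scalerA L1 L2 addrK.
by rewrite -addrA; apply/rowP => i; rewrite !mxE; ring.
Qed.

(** Midpoints are written as affine combinations, so that invariance under
    affine bijections is immediate. *)
Definition midpoint_convex (R : realType) (m : nat) (A : set 'rV[R]_m) : Prop :=
  forall z w, A z -> A w -> A (2^-1 *: z + (1 - 2^-1) *: w).

(** Invariance under the reflection [z |-> 2 p - z] in some point [p]. *)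
Definition point_symmetric (R : realType) (m : nat) (A : set 'rV[R]_m) : Prop :=
  exists p, forall z, A z -> A (2 *: p + (1 - 2) *: z).

Lemma homothetic_midpoint (R : realType) (m s : nat) (S M : set 'rV[R]_m) :
  (s <= m)%N -> homothetic s S M -> midpoint_convex S -> midpoint_convex M.
Proof.
move=> sm /(homothetic_affine sm) [G [Gi -> GA]] H z w Mz Mw.
have [y My] := H _ _ (imageP G Mz) (imageP G Mw).
by rewrite -GA => /Gi <-.
Qed.

Lemma homothetic_symmetric (R : realType) (m s : nat) (S M : set 'rV[R]_m) :
  (s <= m)%N -> homothetic s S M -> point_symmetric M -> point_symmetric S.
Proof.
move=> sm /(homothetic_affine sm) [G [Gi -> GA]] [p H].
by exists (G p) => _ [z Mz <-]; rewrite -GA; exists (2 *: p + (1 - 2) *: z); [exact: H|].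
Qed.

Lemma homothetic_nonempty (R : realType) (m s : nat) (S M : set 'rV[R]_m) :
  homothetic s S M -> S !=set0 -> M !=set0.
Proof. by move=> [g [c [_ _ ->]]] [_ [z Mz _]]; exists z. Qed.

(** Components are carried along by a homothety mapping [B] onto [A]. *)
Lemma component_scale (R : realType) (m : nat) (c : R) (A B : set 'rV[R]_m)
    (z : 'rV[R]_m) : c != 0 -> (forall w, A (c *: w) <-> B w) -> B z ->
  forall w, connected_component A (c *: z) (c *: w) <-> connected_component B z w.
Proof.
move=> c0 H Bz.
have K (d : R) (A' B' : set 'rV[R]_m) x y : d != 0 ->
    (forall w, A' (d *: w) <-> B' w) -> B' x ->
    connected_component B' x y -> connected_component A' (d *: x) (d *: y).
  move=> d0 H' B'x Cy.
  have h : connected ((fun w : 'rV[R]_m => d *: w) @` connected_component B' x).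
    apply: connected_continuous_connected; first exact: component_connected.
    by apply: continuous_subspaceT; exact: scaler_continuous.
  apply: (connected_component_max _ _ h).
  - by exists x => //; exact: connected_component_refl.
  - by move=> _ [u /connected_component_sub Bu <-]; apply/H'.
  - by exists y.
move=> w; split; last exact: K.
have K' : forall w, B (c^-1 *: w) <-> A w.
  by move=> v; rewrite -H scalerA divff// scale1r.
move=> /(K c^-1 _ _ _ _ (invr_neq0 c0) K').
by rewrite !scalerA mulVf// !scale1r; apply; exact/H.
Qed.

Lemma homothetic_component (R : realType) (m s : nat) (c : R) (A B : set 'rV[R]_m)
    (z : 'rV[R]_m) : 0 < c -> (forall w, A (c *: w) <-> B w) -> B z ->
  homothetic s (connected_component A (c *: z)) (connected_component B z).
Proof.
move=> c0 H Bz; apply: (@homothetic_scale _ _ _ c) => // w.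
by apply: component_scale; rewrite ?gt_eqF.
Qed.

(** * Connectedness of the fibres *)

Lemma segment_component (R : realType) (m : nat) (A : set 'rV[R]_m) (z w : 'rV[R]_m) :
  (forall t, 0 <= t <= 1 -> A (t *: (w - z) + z)) -> connected_component A z w.
Proof.
move=> H; apply: (path_component (g := fun t : R => t *: (w - z) + z)).
- move=> t _; apply: cvgD; last exact: cvg_cst.
  exact: continuous_scalel.
- by rewrite scale0r add0r.
- by rewrite scale1r subrK.
- exact: H.
Qed.

(** The segment from [z] to [w] is renormalized in the coordinates of [P]; this
    is possible as long as [w] is not antipodal to [z] in these coordinates. *)
Lemma sphere_component_segment (R : realType) (m : nat) (P : {set 'I_m}) (r : R)
    (z w : 'rV[R]_m) : 0 < r -> sqnorm_on P z = r -> sqnorm_on P w = r ->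
  (exists2 i, i \in P & w 0 i != - z 0 i) ->
  connected_component [set y | sqnorm_on P y = r] z w.
Proof.
move=> r0 zr wr [j jP zw].
pose seg t := t *: (w - z) + z.
pose proj (y : 'rV[R]_m) : 'rV[R]_m := \row_i (if i \in P then y 0 i else 0).
pose f y := Num.sqrt (r / sqnorm_on P y) - 1.
have segE t i : seg t 0 i = t * w 0 i + (1 - t) * z 0 i by rewrite !mxE; ring.
have seg_gt0 t : 0 < sqnorm_on P (seg t).
  rewrite lt_neqAle sqnorm_on_ge0 andbT eq_sym; apply/negP => /eqP.
  move=> /sqnorm_on_eq0 H.
  have E i : i \in P -> t * w 0 i = - ((1 - t) * z 0 i).
    by move=> /H; rewrite segE => /eqP; rewrite addr_eq0 => /eqP.
  have : sqnorm_on P (t *: w) = sqnorm_on P ((1 - t) *: z).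
    by apply: eq_bigr => i iP; rewrite !mxE E// sqrrN.
  rewrite !sqnorm_onZ zr wr => /(mulIf (lt0r_neq0 r0)) tt.
  have t2 : t = 2^-1 by lra.
  have := E j jP; rewrite t2 => Ej; case/negP: zw; apply/eqP; lra.
have projE t : proj (seg t) = t *: proj (w - z) + proj z.
  by apply/rowP => i; rewrite !mxE; case: ifP => _; ring.
apply: (path_component (g := fun t => f (seg t) *: proj (seg t) + seg t)).
- move=> t _.
  have cseg : continuous seg.
    move=> u; apply: cvgD; last exact: cvg_cst.
    exact: continuous_scalel.
  have cproj : continuous (fun t => proj (seg t)).
    move=> u; rewrite (_ : (fun t => _) = fun t => t *: proj (w - z) + proj z).
      by apply: cvgD; [exact: continuous_scalel|exact: cvg_cst].
    by apply/funext => v; exact: projE.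
  have cq : continuous (fun t => sqnorm_on P (seg t)).
    move=> u; apply: (@continuous_comp _ _ _ seg (sqnorm_on P)); first exact: cseg.
    exact: sqnorm_on_continuous.
  apply: cvgD; last exact: cseg.
  apply: cvgZ; last exact: cproj.
  apply: cvgB; last exact: cvg_cst.
  apply: (@continuous_comp _ _ _ (fun t => r / sqnorm_on P (seg t)) Num.sqrt).
    apply: cvgM; first exact: cvg_cst.
    by apply: cvgV; [rewrite gt_eqF|exact: cq].
  exact: sqrt_continuous.
- by rewrite /f /seg scale0r add0r zr divff ?gt_eqF// sqrtr1 subrr scale0r add0r.
- by rewrite /f /seg scale1r subrK wr divff ?gt_eqF// sqrtr1 subrr scale0r add0r.
- move=> t _ /=.
  have -> : sqnorm_on P (f (seg t) *: proj (seg t) + seg t) =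
            sqnorm_on P ((f (seg t) + 1) *: seg t).
    apply: eq_bigr => i iP; move: (seg t) => y; rewrite !mxE iP; congr (_ ^+ 2); ring.
  rewrite sqnorm_onZ /f subrK sqr_sqrtr ?divfK ?gt_eqF//.
  by rewrite divr_ge0 ?sqnorm_on_ge0 ?ltW.
Qed.

Lemma sphere_component (R : realType) (m : nat) (P : {set 'I_m}) (r : R)
    (z w : 'rV[R]_m) : (1 < #|P|)%N -> 0 < r ->
  sqnorm_on P z = r -> sqnorm_on P w = r ->
  connected_component [set y | sqnorm_on P y = r] z w.
Proof.
move=> /card_gt1P [i [j [iP jP ij]]] r0 zr wr.
have [/forall_inP anti|] := boolP [forall l in P, w 0 l == - z 0 l]; last first.
  rewrite negb_forall_in => /exists_inP[l lP zl].
  by apply: sphere_component_segment => //; exists l.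
(* Antipodal points are joined through a point on a coordinate axis. *)
suff [y yr [[a aP ya] [b bP yb]]] : exists2 y : 'rV[R]_m, sqnorm_on P y = r &
    (exists2 a, a \in P & y 0 a != - z 0 a) /\ (exists2 b, b \in P & y 0 b != z 0 b).
  apply: (connected_component_trans (y := y)).
    by apply: sphere_component_segment => //; exists a.
  apply: sphere_component_segment => //; exists b => //.
  by rewrite (eqP (anti b bP)) eqr_opp eq_sym.
pose e l : 'rV[R]_m := Num.sqrt r *: delta_mx 0 l.
have er l : l \in P -> sqnorm_on P (e l) = r.
  by move=> lP; rewrite sqnorm_onZ sqnorm_on_delta lP mulr1 sqr_sqrtr ?ltW.
have eE l l' : e l 0 l' = Num.sqrt r * (l' == l)%:R by rewrite !mxE.
have sr : Num.sqrt r != 0 by rewrite sqrtr_eq0 -ltNge.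
have [zi|zi] := eqVneq (z 0 i) 0.
  exists (e i); first exact: er.
  have h : e i 0 i != 0 by rewrite eE eqxx mulr1.
  by split; exists i; rewrite // zi ?oppr0.
exists (e j); first exact: er.
have h : e j 0 i = 0 by rewrite eE (negbTE ij) mulr0.
by split; exists i; rewrite // h eq_sym ?oppr_eq0.
Qed.

(** A pair of parallel hyperplanes, or a single one if [r = 0], is split into its
    components. *)
Lemma square_fibre_component (R : realType) (m : nat) (i : 'I_m) (r : R)
    (z : 'rV[R]_m) : z 0 i ^+ 2 = r ->
  connected_component [set w : 'rV[R]_m | w 0 i ^+ 2 = r] z =
  [set w | w 0 i = z 0 i].
Proof.
move=> zr.
have free : interval_free [set x : R | x ^+ 2 = r].
  move=> a b ab H.
  have Ha : a ^+ 2 = r by apply: H; rewrite lexx ltW.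
  have Hb : b ^+ 2 = r by apply: H; rewrite lexx ltW.
  have Hm : ((a + b) / 2) ^+ 2 = r by apply: H; lra.
  have : (b - a) ^+ 2 = 0 by move: Ha Hb Hm; rewrite !expr2 => *; lra.
  by move=> /eqP; rewrite sqrf_eq0 subr_eq0 gt_eqF.
rewrite (@component_in_fibre _ _ _ _ _ z (@coord_continuous _ _ _ 0 i) free)//.
rewrite (_ : _ `&` _ = [set w : 'rV[R]_m | w 0 i = z 0 i]).
  apply: component_fullT => // x y /= xi yi; apply: segment_component => t _ /=.
  by rewrite !mxE xi yi subrr mulr0 add0r.
by apply/seteqP; split=> w /=; [case|move=> wz; split => //; rewrite wz].
Qed.
(** * The model hypersurfaces *)

Lemma parab_line (R : realType) (m s omega : nat) (eps : nat -> R)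
    (z w : 'rV[R]_m) (h : R) :
  parab s omega eps (h *: w + z) = parab s omega eps z
  + h * (2 * \sum_(i < s) (tc z i - eps i * xc s z i) * (tc w i - eps i * xc s w i)
         + 2 * \sum_(s <= j < s + omega) xc s w j)
  + h ^+ 2 * \sum_(i < s) (tc w i - eps i * xc s w i) ^+ 2.
Proof.
rewrite /parab /xc.
have -> : \sum_(s <= j < s + omega) tc (h *: w + z) (s + j) =
    h * \sum_(s <= j < s + omega) tc w (s + j) + \sum_(s <= j < s + omega) tc z (s + j).
  by rewrite mulr_sumr -big_split; apply: eq_bigr => j _; rewrite tcD tcZ.
have -> : \sum_(i < s) (tc (h *: w + z) i - eps i * tc (h *: w + z) (s + i)) ^+ 2 =
    \sum_(i < s) (tc z i - eps i * tc z (s + i)) ^+ 2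
    + 2 * h * \sum_(i < s) (tc z i - eps i * tc z (s + i)) * (tc w i - eps i * tc w (s + i))
    + h ^+ 2 * \sum_(i < s) (tc w i - eps i * tc w (s + i)) ^+ 2.
  rewrite !mulr_sumr -!big_split; apply: eq_bigr => i _ /=.
  by rewrite !tcD !tcZ; ring.
by ring.
Qed.

Lemma parab0 (R : realType) (m s omega : nat) (eps : nat -> R) :
  parab s omega eps (0 : 'rV[R]_m) = 0.
Proof.
rewrite /parab /xc !big1 ?mulr0 ?addr0// => i _; rewrite ?tc0//.
by rewrite mulr0 subrr expr0n.
Qed.

Lemma parab_continuous (R : realType) (m s omega : nat) (eps : nat -> R) :
  continuous (fun z : 'rV[R]_m => parab s omega eps z).
Proof.
have c1 : continuous (fun z : 'rV[R]_m => \sum_(i < s) (tc z i - eps i * xc s z i) ^+ 2).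
  apply: sum_continuous => i _ z.
  have h : {for z, continuous (fun z : 'rV[R]_m => tc z i - eps i * xc s z i)}.
    apply: (@continuousB _ _ _ (fun z : 'rV[R]_m => tc z i)); first exact: tc_continuous.
    by apply: continuousM; [exact: cst_continuous|exact: tc_continuous].
  exact: (continuousM h h).
have c2 : continuous (fun z : 'rV[R]_m => \sum_(s <= j < s + omega) xc s z j).
  by apply: sum_continuous => j _; exact: tc_continuous.
move=> z; apply: (continuousD (c1 z)).
by apply: (continuousM _ (c2 z)); exact: cst_continuous.
Qed.

(** The variable [x_(s+1)], in which the parabolic function is affine. *)
Lemma parab_delta (R : realType) (m s omega : nat) (eps : nat -> R) (j : 'I_m)
    (z : 'rV[R]_m) (h : R) :
  j = (s + s)%N :> nat -> (1 <= omega)%N ->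
  parab s omega eps (h *: delta_mx 0 j + z) = parab s omega eps z + 2 * h.
Proof.
move=> js om.
have i0 (i : 'I_s) : tc (delta_mx 0 j : 'rV[R]_m) i - eps i * xc s (delta_mx 0 j) i = 0.
  rewrite /xc !tc_delta js eqn_add2l.
  have -> : (i == s + s :> nat)%N = false by rewrite ltn_eqF// ltn_addr.
  by rewrite (ltn_eqF (ltn_ord i)) mulr0 subrr.
rewrite parab_line [\sum_(i < s) _]big1; last by move=> i _; rewrite i0 mulr0.
rewrite [\sum_(i < s) _]big1; last by move=> i _; rewrite i0 expr0n.
have -> : \sum_(s <= l < s + omega) xc s (delta_mx 0 j : 'rV[R]_m) l = 1.
  have so : (s < s + omega)%N by rewrite -[X in (X < _)%N]addn0 ltn_add2l.
  rewrite (big_ltn so) big_nat_cond big1 ?addr0.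
    by rewrite /xc tc_delta js eqxx.
  move=> l /andP[/andP[sl _] _]; rewrite /xc tc_delta js eqn_add2l.
  by rewrite gtn_eqF.
by ring.
Qed.

Section ParabolicShape.
Context (R : realType) (m s omega : nat) (eps : nat -> R) (c : R).
Hypotheses (s0 : (0 < s)%N) (sm : (s < m - s)%N) (om : (1 <= omega)%N).

Let P := [set z : 'rV[R]_m | parab s omega eps z = c].

Let m0 : (0 < m)%N. Proof. by move: sm; case: m. Qed.
Let ssm : (s + s < m)%N. Proof. by rewrite -ltn_subRL. Qed.
Let et : 'rV[R]_m := delta_mx 0 (Ordinal m0).
Let ex : 'rV[R]_m := delta_mx 0 (Ordinal ssm).

Let parab_ex z h : parab s omega eps (h *: ex + z) = parab s omega eps z + 2 * h.
Proof. exact: parab_delta. Qed.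

Let parab_et z : exists a, forall h,
  parab s omega eps (h *: et + z) = parab s omega eps z + h * a + h ^+ 2.
Proof.
eexists => h; rewrite parab_line; congr (_ + _).
rewrite (bigD1 (Ordinal s0))//= big1 ?addr0.
  by rewrite /xc !tc_delta/= addn0 (gtn_eqF s0) mulr0 subr0 expr1n mulr1.
move=> i; rewrite -val_eqE/= => i0.
rewrite /xc !tc_delta/= (negbTE i0) gtn_eqF ?addn_gt0 ?s0// mulr0 subr0.
by rewrite expr0n.
Qed.

Lemma parabolic_nonempty : P !=set0.
Proof.
exists ((c / 2) *: ex + 0); rewrite /P /= parab_ex parab0; by field.
Qed.

Lemma parabolic_not_midpoint_convex : ~ midpoint_convex P.
Proof.
have [a Ha] := parab_et 0.
move=> /(_ (((c - 1 - a) / 2) *: ex + (1 *: et + 0)) (((c - 1 + a) / 2) *: ex + ((-1) *: et + 0))).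
rewrite /P /= !parab_ex !Ha parab0.
have -> : 2^-1 *: ((c - 1 - a) / 2 *: ex + (1 *: et + 0)) +
   (1 - 2^-1) *: ((c - 1 + a) / 2 *: ex + (-1 *: et + 0)) = ((c - 1) / 2) *: ex + 0.
  by apply/rowP => i; rewrite !mxE; field.
rewrite parab_ex parab0 => H.
have : 0 + 2 * ((c - 1) / 2) = c by apply: H; field.
lra.
Qed.

(** The points [h e_t + f(h) e_x] of the parabola are not mapped into it by a
    point reflection, as [2 h^2] would have to be affine in [h]. *)
Lemma parabolic_not_symmetric : ~ point_symmetric P.
Proof.
have [a Ha] := parab_et 0.
move=> [p H]; have [b Hb] := parab_et (2 *: p).
have K h : parab s omega eps (2 *: p) - h * b + h ^+ 2
    + (h * a + h ^+ 2 - c) = c.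
  pose f := (c - h * a - h ^+ 2) / 2.
  have Pf : P (f *: ex + (h *: et + 0)).
    by rewrite /P /= parab_ex Ha parab0 /f; field.
  have := H _ Pf; rewrite /P /=.
  have -> : 2 *: p + (1 - 2) *: (f *: ex + (h *: et + 0)) =
            (- f) *: ex + ((- h) *: et + 2 *: p).
    by apply/rowP => i; rewrite !mxE; ring.
  by rewrite parab_ex Hb /f => E; rewrite -[RHS]E; field.
have := K 0; have := K 1; have := K (-1); lra.
Qed.

(** A fibre of the parabolic function is a graph over the hyperplane normal to
    [e_x]: the segment from [z] to [w] is pushed back into it along [e_x]. *)
Lemma parabolic_component (z w : 'rV[R]_m) : P z -> P w -> connected_component P z w.
Proof.
move=> Pz Pw.
pose seg t := t *: (w - z) + z.
pose f t := (c - parab s omega eps (seg t)) / 2.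
have cseg : continuous seg.
  by move=> t; apply: cvgD; [exact: continuous_scalel|exact: cvg_cst].
apply: (path_component (g := fun t : R => f t *: ex + seg t)).
- move=> t _; apply: cvgD; last exact: cseg.
  apply: continuous_scalel; apply: cvgM; last exact: cvg_cst.
  apply: cvgB; first exact: cvg_cst.
  apply: (@continuous_comp _ _ _ seg (fun z => parab s omega eps z)).
    exact: cseg.
  exact: parab_continuous.
- by rewrite /f /seg scale0r add0r Pz subrr mul0r scale0r add0r.
- by rewrite /f /seg scale1r subrK Pw subrr mul0r scale0r add0r.
- by move=> t _; rewrite /P /= parab_ex /f; field.
Qed.

End ParabolicShape.

Lemma parabolic_modelE (R : realType) (m s omega : nat) (eps : nat -> R) (c : R) :
  coord_proj s s (s + omega) @^-1` parabolic_cylinder eps c =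
  [set z : 'rV[R]_m | parab s omega eps z = c].
Proof.
suff E (z : 'rV[R]_m) : parab s omega eps (coord_proj s s (s + omega) z) = parab s omega eps z.
  by apply/seteqP; split=> z; rewrite /parabolic_cylinder /= E.
rewrite /parab; congr (_ + 2 * _).
  apply: eq_bigr => i _; congr (_ ^+ 2); congr (_ - _ * _).
    by rewrite tc_coord_proj ?ltn_ord// ltn_addr.
  rewrite {1}/xc tc_coord_proj ?ltn_add2l ?ltn_addr//.
  by rewrite ltnNge leq_addr addKn.
apply: eq_big_nat => j /andP[sj js].
rewrite {1}/xc tc_coord_proj ?ltn_add2l//.
by rewrite ltnNge leq_addr addKn.
Qed.

Lemma sphere_x_modelE (R : realType) (m s n : nat) : (s + n <= m)%N ->
  coord_proj s 0 n @^-1` pseudosphere 0 1 =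
  [set z : 'rV[R]_m | sqnorm_on (x_indices m s n) z = 1].
Proof.
move=> snm; apply/seteqP; split=> z;
  by rewrite /pseudosphere /= mink0_coord_proj_x sqnorm_x.
Qed.

Lemma sphere_t_modelE (R : realType) (m s k : nat) : (k <= m)%N ->
  coord_proj s k 0 @^-1` pseudosphere 0 1 =
  [set z : 'rV[R]_m | sqnorm_on (t_indices m k) z = 1].
Proof.
move=> km; apply/seteqP; split=> z;
  by rewrite /pseudosphere /= mink0_coord_proj_t sqnorm_t.
Qed.

Lemma flat_tE (R : realType) (m k : nat) :
  @flat_t R m k = [set z : 'rV[R]_m | sqnorm_on (t_indices m k) z = 0].
Proof.
apply/seteqP; split=> z /=.
  by move=> H; apply/sqnorm_on_eq0 => i; rewrite inE -tcE => /H.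
move=> /sqnorm_on_eq0 H i ik; have [im|mi] := ltnP i m; last exact: tc_out.
by rewrite (tcE _ (Ordinal im)) H// inE.
Qed.

Lemma flat_xE (R : realType) (m s n : nat) :
  flat_x s n = [set z : 'rV[R]_m | sqnorm_on (x_indices m s n) z = 0].
Proof.
apply/seteqP; split=> z /=.
  move=> H; apply/sqnorm_on_eq0 => i; rewrite inE -tcE => /andP[si isn].
  by rewrite -(subnKC si); apply: H; rewrite ltn_subLR.
move=> /sqnorm_on_eq0 H j jn; rewrite /xc.
have [im|mi] := ltnP (s + j) m; last exact: tc_out.
by rewrite (tcE _ (Ordinal im)) H// inE /= leq_addr ltn_add2l.
Qed.

Lemma sphere_symmetric (R : realType) (m : nat) (P : {set 'I_m}) (r : R) :
  point_symmetric [set z : 'rV[R]_m | sqnorm_on P z = r].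
Proof.
exists 0 => z /= zr; rewrite scaler0 add0r.
have -> : (1 - 2 : R) = -1 by ring.
by rewrite scaleN1r sqnorm_onN.
Qed.

Lemma sphere_nonempty (R : realType) (m : nat) (P : {set 'I_m}) (r : R) :
  0 <= r -> (0 < #|P|)%N -> [set z : 'rV[R]_m | sqnorm_on P z = r] !=set0.
Proof.
move=> r0 /card_gt0P[i iP]; exists (Num.sqrt r *: delta_mx 0 i) => /=.
by rewrite sqnorm_onZ sqnorm_on_delta iP mulr1 sqr_sqrtr.
Qed.

Lemma sphere_not_midpoint_convex (R : realType) (m : nat) (P : {set 'I_m}) (r : R) :
  0 < r -> (0 < #|P|)%N -> ~ midpoint_convex [set z : 'rV[R]_m | sqnorm_on P z = r].
Proof.
move=> r0 P0 H; have [z zr] := sphere_nonempty (ltW r0) P0.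
have := H z (- z) zr; rewrite /= sqnorm_onN => /(_ zr).
have -> : 2^-1 *: z + (1 - 2^-1) *: - z = 0.
  by apply/rowP => i; rewrite !mxE; field.
by rewrite sqnorm_on0 => r00; rewrite -r00 ltxx in r0.
Qed.

Lemma sphere_empty (R : realType) (m : nat) (P : {set 'I_m}) :
  P = finset.set0 -> ~ ([set z : 'rV[R]_m | sqnorm_on P z = 1] !=set0).
Proof.
move=> -> [z] /=; rewrite /sqnorm_on big_set0 => /eqP.
by rewrite eq_sym oner_eq0.
Qed.


Lemma t_indicesE (m k : nat) : t_indices m k = x_indices m 0 k.
Proof. by apply/setP => i; rewrite !inE. Qed.

Lemma x_indices0 (m s : nat) : x_indices m s 0 = finset.set0.
Proof.
by apply/setP => i; rewrite !inE addn0; apply/negP => /andP[]; rewrite ltnNge => ->.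
Qed.

Lemma x_indices1 (m s : nat) (i : 'I_m) : i = s :> nat ->
  x_indices m s 1 = (finset.set1 i).
Proof.
by move=> is_; apply/setP => j; rewrite !inE -val_eqE/= is_ addn1 ltnS eqn_leq andbC.
Qed.

Lemma x_indices_gt0 (m s n : nat) : (s + n <= m)%N -> (0 < n)%N ->
  (0 < #|x_indices m s n|)%N.
Proof.
move=> snm n0; have sm : (s < m)%N by apply: leq_trans snm; rewrite -addn1 leq_add2l.
by apply/card_gt0P; exists (Ordinal sm); rewrite inE /= leqnn -addn1 leq_add2l.
Qed.

Lemma x_indices_gt1 (m s n : nat) : (s + n <= m)%N -> (1 < n)%N ->
  (1 < #|x_indices m s n|)%N.
Proof.
move=> snm n1; have sm1 : (s.+1 < m)%N by apply: leq_trans snm; rewrite -addn2 leq_add2l.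
have sm : (s < m)%N := ltnW sm1.
apply/card_gt1P; exists (Ordinal sm), (Ordinal sm1); split.
- by rewrite inE /= leqnn -addn1 leq_add2l ltnW.
- by rewrite inE /= leqnSn -addn2 leq_add2l.
- by rewrite -val_eqE /= ltn_eqF.
Qed.

Lemma sqnorm_on1 (R : realType) (m : nat) (i : 'I_m) (z : 'rV[R]_m) :
  sqnorm_on (finset.set1 i) z = z 0 i ^+ 2.
Proof. by rewrite /sqnorm_on big_set1. Qed.

(** A hyperplane orthogonal to a time axis is not homothetic to one orthogonal
    to a space axis: an isometry maps the normal line to the normal line and
    preserves its causal character. *)
Lemma coordinate_hyperplanes_not_homothetic (R : realType) (m s : nat) (i j : 'I_m) :
  (s <= m)%N -> (i < s)%N != (j < s)%N ->
  ~ homothetic s [set z : 'rV[R]_m | z 0 i = 0] [set z | z 0 j = 0].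
Proof.
move=> sm ij [g [c [ig c0 E]]].
have [inner lin] := isometry_linear sm ig.
have cN0 : c != 0 by rewrite gt_eqF.
have g0i : g 0 0 i = 0.
  have : [set g (c *: z) | z in [set z : 'rV[R]_m | z 0 j = 0]] (g 0).
    by exists 0; rewrite /= ?mxE// scaler0.
  by rewrite -E.
pose f := g (delta_mx 0 j) - g 0.
have fl l : l != i -> f 0 l = 0.
  move=> li.
  have : [set z : 'rV[R]_m | z 0 i = 0] (delta_mx 0 l + g 0).
    by rewrite /= mxE g0i mxE eq_sym (negbTE li) andbF addr0.
  rewrite E => -[z /= zj gz].
  have fz : g (c *: z) - g 0 = delta_mx 0 l by rewrite gz addrK.
  have := inner (delta_mx 0 j) (c *: z).
  have czj : (c *: z) 0 j = 0 by rewrite mxE zj mulr0.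
  rewrite fz -/f mink_delta// [RHS]minkC mink_delta// czj mulr0.
  by move=> /eqP; rewrite mulf_eq0 signr_eq0 => /eqP.
have := inner (delta_mx 0 j) (delta_mx 0 j).
rewrite -/f [RHS]mink_delta// mink_sum// (bigD1 i)//= big1 ?addr0; last first.
  by move=> l li; rewrite fl// !mulr0.
have -> : (delta_mx 0 j : 'rV[R]_m) 0 j = 1 by rewrite mxE !eqxx.
rewrite mulr1 -expr2; have := sqr_ge0 (f 0 i).
move: ij; case: (i < s)%N; case: (j < s)%N => //= _; rewrite ?expr1 ?expr0; lra.
Qed.

(** What tells the model hypersurfaces apart. *)
Lemma model_shape (R : realType) (m s k n : nat) o (M : set 'rV[R]_m) :
  (0 < s)%N -> (k <= m)%N -> (s + n <= m)%N -> model s k n o M ->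
  match o with
  | Hyperplane_a | Flat_s | Flat_s1 => midpoint_convex M
  | Parabolic => ~ midpoint_convex M /\ ~ point_symmetric M
  | Flat_x_Sphere => if n is 0%N then ~ (M !=set0) else ~ midpoint_convex M
  | Sphere_x_Flat => if k is 0%N then ~ (M !=set0) else ~ midpoint_convex M
  end.
Proof.
move=> s0 km snm; case: o => /=.
- move=> [a _ ->] z w /= az aw.
  by rewrite !(minkDr, minkZr) az aw !mulr0 addr0.
- move=> -> z w zi wi i i1; have := zi i i1; have := wi i i1.
  by rewrite /xc tcD !tcZ => -> ->; rewrite !mulr0 addr0.
- move=> -> z w zi wi i i1; rewrite tcD !tcZ zi// wi//.
  by rewrite !mulr0 addr0.
- move=> [omega [eps [c [sm /andP[om _] _ ->]]]]; rewrite parabolic_modelE.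
  by split; [exact: parabolic_not_midpoint_convex|exact: parabolic_not_symmetric].
- move=> ->; rewrite sphere_x_modelE//; case: n snm => [_|n snm].
    by apply: sphere_empty; exact: x_indices0.
  by apply: sphere_not_midpoint_convex => //; exact: x_indices_gt0.
- move=> ->; rewrite sphere_t_modelE// t_indicesE; case: k km => [_|k km].
    by apply: sphere_empty; exact: x_indices0.
  by apply: sphere_not_midpoint_convex => //; exact: x_indices_gt0.
Qed.

(** Among the models, only hyperplanes are homothetic to a midpoint convex set. *)
Lemma compatible_planar (R : realType) (m s k n : nat) o (M M' : set 'rV[R]_m) :
  (0 < s)%N -> (s <= m)%N -> (k <= m)%N -> (s + n <= m)%N ->
  midpoint_convex M -> M !=set0 -> model s k n o M' -> homothetic s M M' ->
  o = Hyperplane_a \/ o = Flat_s \/ o = Flat_s1.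
Proof.
move=> s0 sm km snm Mc M0 HM' MM'.
have M'c := homothetic_midpoint sm MM' Mc.
have M'0 := homothetic_nonempty MM' M0.
have := model_shape s0 km snm HM'; case: o HM' => _; try by auto.
- by case.
- by case: n snm.
- by case: k km.
Qed.
(** * The reduced equation *)

Section ReducedEquation.
(** The solution [v] lives on an interval [I] containing [0], with derivatives
    [v1] and [v2] relative to [I].  The leading coefficient [A] may vanish at [0],
    but is bounded away from zero outside each neighbourhood of [0]. *)
Context (R : realType) (p mu : R) (A : R -> R) (B : R) (I : set R) (v v1 v2 : R -> R).
Hypotheses (p1 : 1 < p) (mu0 : mu != 0) (iI : is_interval I) (I0 : I 0).
Hypothesis dv : forall t, I t -> deriv_within I v t (v1 t).
Hypothesis dv1 : forall t, I t -> deriv_within I v1 t (v2 t).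
Hypothesis ode : forall t, I t ->
  A t * v2 t + B * v1 t = - mu * `|v t| `^ (p - 1) * v t.
Hypothesis A_gt : forall x : R, 0 < x -> exists2 c : R, 0 < c & forall t, x <= `|t| -> c <= `|A t|.
Hypothesis v0 : 0 < v 0.

Lemma interval_nbhs (J : set R) (a b t : R) : is_interval J -> J a -> J b -> a < t < b -> nbhs t J.
Proof.
move=> iJ Ja Jb /andP[at_ tb]; near=> r; apply: (iJ a b) => //.
apply/andP; split; near: r; first exact: lt_le_nbhsr.
exact: lt_le_nbhsl.
Unshelve. all: by end_near. Qed.

Lemma is_derive_v t : nbhs t I -> is_derive t 1 v (v1 t).
Proof. by move=> It; apply: (deriv_within_interior It); apply: dv; exact: nbhs_singleton. Qed.

Lemma is_derive_v1 t : nbhs t I -> is_derive t 1 v1 (v2 t).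
Proof. by move=> It; apply: (deriv_within_interior It); apply: dv1; exact: nbhs_singleton. Qed.

Lemma v2_bound (x y c : R) : x <= y -> (forall t, x <= t <= y -> nbhs t I) -> 0 < c ->
  (forall t, x <= t <= y -> c <= `|A t|) ->
  exists2 K, 0 <= K & forall t, x <= t <= y -> `|v2 t| <= K * (`|v t| + `|v1 t|).
Proof.
move=> xy HI c0 HA.
have cv : {within `[x, y], continuous (fun t => `|v t|)}.
  have h : {within `[x, y], continuous v}.
    apply: derivable_within_continuous => t; rewrite in_itv/= => txy.
    by have := is_derive_v (HI t txy) => d; exact: ex_derive.
  move=> t; apply: (@continuous_comp _ _ _ (v : subspace `[x, y] -> R) (@Num.norm R R)); first exact: h.
  exact: norm_continuous.
have [d _ dmax] := EVT_max xy cv.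
pose D := `|v d| `^ (p - 1).
have D0 : 0 <= D by exact: powR_ge0.
exists ((`|mu| * D + `|B|) / c).
  by apply: divr_ge0; [rewrite addr_ge0// mulr_ge0|exact: ltW].
move=> t txy.
have It : I t by apply: nbhs_singleton; exact: HI.
have cA := HA t txy.
have A0 : 0 < `|A t| by apply: lt_le_trans cA.
rewrite mulrAC ler_pdivlMr// mulrC.
apply: (@le_trans _ _ (`|A t * v2 t|)); first by rewrite normrM ler_wpM2r.
have -> : A t * v2 t = - (mu * `|v t| `^ (p - 1) * v t) - B * v1 t.
  by rewrite -[LHS](addrK (B * v1 t)) ode//; ring.
apply: le_trans (ler_normB _ _) _; rewrite normrN !normrM.
have vD : `| `|v t| `^ (p - 1) | <= D.
  rewrite ger0_norm ?powR_ge0//; apply: ge0_ler_powR; rewrite ?nnegrE//.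
    by rewrite subr_ge0 ltW.
  by apply: dmax; rewrite in_itv.
have h1 : `|mu| * `| `|v t| `^ (p - 1) | * `|v t| <= `|mu| * D * `|v t|.
  by rewrite ler_wpM2r// ler_wpM2l.
have h2 : 0 <= `|mu| * D * `|v1 t| by rewrite !mulr_ge0.
have h3 : 0 <= `|B| * `|v t| by rewrite mulr_ge0.
rewrite mulrDl !mulrDr; lra.
Qed.

(** A nontrivial solution has no double zero: otherwise it would vanish between
    that zero and [0], hence at [0] as well by continuity. *)
Lemma no_double_zero t : nbhs t I -> t != 0 -> v t = 0 -> v1 t <> 0.
Proof.
move=> It tN0 vt v1t.
have It' := nbhs_singleton It.
have [r0 r00 Hr0] := deriv_within_continuous (dv I0) v0.
suff [r [Ir rr0 vr]] : exists r, [/\ I r, `|r| < r0 & v r = 0].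
  have := Hr0 r Ir; rewrite subr0 => /(_ rr0); rewrite vr sub0r normrN.
  by rewrite ltNge ler_norm.
have nI x : 0 < x * t -> `|x| <= `|t| -> nbhs x I.
  move=> xt0 xt; have [->//|nxt] := eqVneq x t.
  have [t0|t0|t0] := ltgtP t 0; last by rewrite t0 eqxx in tN0.
    have x0 : x < 0 by rewrite -(nmulr_lgt0 _ t0).
    apply: (interval_nbhs iI It' I0); rewrite x0 andbT lt_neqAle eq_sym nxt/=.
    by move: xt; rewrite !ltr0_norm// lerN2.
  have x0 : 0 < x by rewrite -(pmulr_lgt0 _ t0).
  apply: (interval_nbhs iI I0 It'); rewrite x0 lt_neqAle nxt/=.
  by move: xt; rewrite !gtr0_norm.
pose q := Num.min (`|t|) (r0 / 2).
have tn : 0 < `|t| by rewrite normr_gt0.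
have q0 : 0 < q by rewrite lt_min tn divr_gt0.
have qt : q <= `|t| by rewrite ge_min lexx.
have qr : q < r0.
  apply: le_lt_trans (_ : r0 / 2 < r0); first by rewrite ge_min lexx orbT.
  lra.
have [c c0 HA] := A_gt q0.
have [t0|t0|t0] := ltgtP t 0; last by rewrite t0 eqxx in tN0.
- have tE : `|t| = - t by rewrite ltr0_norm.
  have tq : t <= - q by rewrite -lerN2 opprK -tE.
  have J x : t <= x <= - q -> nbhs x I.
    move=> /andP[tx xq]; have x0 : x < 0 by apply: le_lt_trans xq _; rewrite oppr_lt0.
    by apply: nI; rewrite ?nmulr_rgt0// tE ltr0_norm// lerN2.
  have HA' x : t <= x <= - q -> c <= `|A x|.
    move=> /andP[tx xq]; apply: HA; rewrite ler0_norm; first by rewrite lerNr.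
    by apply: le_trans xq _; rewrite oppr_le0 ltW.
  have [K K0 HK] := v2_bound tq J c0 HA'.
  exists (- q); rewrite normrN gtr0_norm//; split=> //.
    by apply: nbhs_singleton; apply: J; rewrite tq lexx.
  apply: (gronwall_right tq K0 _ _ HK vt v1t) => x /J.
    exact: is_derive_v.
  exact: is_derive_v1.
have tE : `|t| = t by rewrite gtr0_norm.
have tq : q <= t by rewrite -tE.
have J x : q <= x <= t -> nbhs x I.
  move=> /andP[tx xq]; have x0 : 0 < x by apply: lt_le_trans tx.
  by apply: nI; rewrite ?pmulr_rgt0// tE gtr0_norm.
have HA' x : q <= x <= t -> c <= `|A x|.
  by move=> /andP[tx xq]; apply: HA; rewrite ger0_norm// (le_trans _ tx)// ltW.
have [K K0 HK] := v2_bound tq J c0 HA'.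
exists q; rewrite gtr0_norm//; split=> //.
  by apply: nbhs_singleton; apply: J; rewrite tq lexx.
apply: (gronwall_left tq K0 _ _ HK vt v1t) => x /J.
  exact: is_derive_v.
exact: is_derive_v1.
Qed.

Lemma subinterval_off_zero (a b : R) : a < b ->
  exists a' b', [/\ a' < b', a <= a', b' <= b & forall t, a' < t < b' -> t != 0].
Proof.
move=> ab; have [a0|a0] := leP 0 a.
  exists a, b; split=> // t /andP[at_ _]; rewrite gt_eqF//; lra.
exists a, (Num.min b 0); split=> //; first by rewrite lt_min ab.
  by rewrite ge_min lexx.
by move=> t /andP[_]; rewrite lt_min => /andP[_ t0]; rewrite lt_eqF.
Qed.

Lemma ode_zero t : I t -> v1 t = 0 -> v2 t = 0 -> v t = 0.
Proof.
move=> It v1t v2t; have := ode It; rewrite v1t v2t !mulr0 addr0 => /eqP.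
rewrite eq_sym !mulf_eq0 oppr_eq0 (negbTE mu0)/= => /orP[|/eqP//].
by rewrite powR_eq0 normr_eq0 => /andP[/eqP].
Qed.

(** On a segment where [v = c], both derivatives of [v] vanish; the equation then
    gives [c = 0], that is, a double zero. *)
Lemma level_interval_free c : interval_free [set t | I t /\ v t = c].
Proof.
move=> a b /subinterval_off_zero[a' [b' [ab aa bb off]]] H.
have H' t : a' < t < b' -> nbhs t I /\ v t = c.
  move=> t'; have /andP[at_ tb] := t'; split.
    by apply: (interval_nbhs iI _ _ t'); apply H; apply/andP; split; lra.
  by apply H; apply/andP; split; lra.
have v10 t : a' < t < b' -> v1 t = 0.
  move=> t'; apply: (derive_locally_constant t' (f := v) (c := c)).
    by move=> r /H'[].
  by apply: is_derive_v; have [] := H' _ t'.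
have v20 t : a' < t < b' -> v2 t = 0.
  move=> t'; apply: (derive_locally_constant t' (f := v1) (c := 0)) => //.
  by apply: is_derive_v1; have [] := H' _ t'.
have tt : a' < (a' + b') / 2 < b' by apply/andP; split; lra.
have [It _] := H' _ tt.
apply: (no_double_zero It (off _ tt)); last exact: v10.
by apply: ode_zero; [exact: nbhs_singleton|exact: v10|exact: v20].
Qed.

Lemma critical_interval_free : interval_free [set t | I t /\ (t = 0 \/ v1 t = 0)].
Proof.
move=> a b /subinterval_off_zero[a' [b' [ab aa bb off]]] H.
have H' t : a' < t < b' -> nbhs t I /\ v1 t = 0.
  move=> t'; have /andP[at_ tb] := t'; split.
    by apply: (interval_nbhs iI _ _ t'); apply H; apply/andP; split; lra.
  have [_ [t0|//]] : I t /\ (t = 0 \/ v1 t = 0) by apply H; apply/andP; split; lra.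
  by have := off _ t'; rewrite t0 eqxx.
have v20 t : a' < t < b' -> v2 t = 0.
  move=> t'; apply: (derive_locally_constant t' (f := v1) (c := 0)).
    by move=> r /H'[].
  by apply: is_derive_v1; have [] := H' _ t'.
have tt : a' < (a' + b') / 2 < b' by apply/andP; split; lra.
have [It v1t] := H' _ tt.
apply: (no_double_zero It (off _ tt)) => //.
by apply: ode_zero; [exact: nbhs_singleton|exact: v1t|exact: v20].
Qed.

(** In the quadratic case with at least two effective variables the function
    [2 t v1^2 + (mu / alpha) |v|^(p+1) / (p+1)] is nonincreasing, strictly so
    near [0] because [v1 0 <> 0].  At a critical point it is a function of the
    critical value alone, so that no critical value other than [v 0] is close
    to [v 0]. *)
Lemma regular_values_near_zero (alpha : R) (N : nat) : alpha != 0 -> (2 <= N)%N ->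
  (forall t, A t = 4 * alpha * t) -> B = 2 * N%:R * alpha ->
  (forall t, I t -> nbhs t I) ->
  exists2 del, 0 < del & forall sigma, 0 < `|sigma| < del ->
    I sigma /\ (forall t, I t -> v t = v sigma -> t != 0 /\ v1 t != 0).
Proof.
move=> al0 N2 AE BE oI.
have N2' : 2 <= N%:R :> R by rewrite ler_nat.
pose kap := mu / alpha.
have kap0 : kap != 0 by rewrite mulf_neq0 ?invr_neq0.
pose Gam (x : R) : R := kap * ((p + 1)^-1 * `|x| `^ (p + 1)).
have p10 : p + 1 != 0 by rewrite gt_eqF// addr_gt0// (lt_trans _ p1).
have dGam (x : R) : is_derive x 1 Gam (kap * (`|x| `^ (p - 1) * x)).
  have D := is_deriveZ kap (is_deriveZ (p + 1)^-1 (is_derive_powR_abs x p1)).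
  by apply: is_derive_eq D _; rewrite /GRing.scale/= mulKf.
pose G t := 2 * (t * v1 t ^+ 2) + Gam (v t).
have dG t : I t -> is_derive t 1 G (- (2 * (N%:R - 1) * v1 t ^+ 2)).
  move=> It.
  have D1 := is_derive_v (oI _ It); have D2 := is_derive_v1 (oI _ It).
  have D3 := @is_derive1_comp _ Gam v t _ _ (dGam (v t)) D1.
  have D4 := is_deriveD (is_deriveZ 2 (is_deriveM (is_derive_id t 1) (is_deriveX 2 D2))) D3.
  apply: is_derive_eq D4 _.
  rewrite /GRing.scale /= !fctE /= /kap.
  have := ode It; rewrite AE BE => E.
  have E2 : mu / alpha * (`|v t| `^ (p - 1) * v t) = - (4 * t * v2 t + 2 * N%:R * v1 t).
    have -> : mu / alpha * (`|v t| `^ (p - 1) * v t) = - ((- mu * `|v t| `^ (p - 1) * v t) / alpha).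
      by field.
    by rewrite -E; field.
  by rewrite E2; ring.
have Gle a b : I a -> I b -> a <= b -> G b <= G a.
  move=> Ia Ib ab; apply: (nonincreasing_derive ab (df := fun t => - (2 * (N%:R - 1) * v1 t ^+ 2))).
    by move=> x xab; apply: dG; apply: (iI Ia Ib).
  by move=> x _; rewrite oppr_le0 mulr_ge0 ?sqr_ge0// mulr_ge0// subr_ge0; lra.
have v10 : v1 0 != 0.
  apply/negP => /eqP v10; have := ode I0; rewrite AE mulr0 mul0r v10 mulr0 addr0 => /eqP.
  rewrite eq_sym !mulf_eq0 oppr_eq0 (negbTE mu0)/= powR_eq0 normr_eq0 (gt_eqF v0).
  by [].
have cv1 : {for 0, continuous v1}.
  have D := is_derive_v1 (oI _ I0).
  exact/differentiable_continuous/derivable1_diffP/ex_derive.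
have [d1 /= d10 Hd1] : nbhs (0 : R) [set t | v1 t != 0 /\ I t].
  apply: filterI; last exact: oI.
  have N0 : nbhs (v1 0) [set x : R | x != 0].
    by apply: open_nbhs_nbhs; split=> //; exact: open_neq.
  exact: cv1 N0.
(* Critical points are sought separately inside and outside [(-t0, t0)]: there
   are none inside, and outside [G] has left the interval [(G t0, G (- t0))]. *)
pose t0 := d1 / 2.
have t00 : 0 < t0 by rewrite divr_gt0.
have t0d : t0 < d1 by rewrite /t0; lra.
have near0 t : `|t| < d1 -> v1 t != 0 /\ I t.
  by move=> td; apply: Hd1; rewrite /ball /= sub0r normrN.
have Gpos t : `|t| < d1 -> - (2 * (N%:R - 1) * v1 t ^+ 2) < 0.
  move=> /near0[v1t _]; rewrite oppr_lt0 mulr_gt0 ?exprn_even_gt0//.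
  by rewrite mulr_gt0// subr_gt0; lra.
have IG a b t : I a -> I b -> a <= t <= b -> is_derive t 1 G (- (2 * (N%:R - 1) * v1 t ^+ 2)).
  by move=> Ia Ib tab; apply: dG; apply: (iI Ia Ib).
have It0 : I t0 by apply near0; rewrite gtr0_norm.
have Imt0 : I (- t0) by apply near0; rewrite normrN gtr0_norm.
have G0 : G 0 = Gam (v 0) by rewrite /G mul0r mulr0 add0r.
have Gr : G t0 < G 0.
  have [c /andP[c0 ct] E] := MVT_derive t00 (fun t => IG 0 t0 t I0 It0).
  by rewrite -subr_lt0 E pmulr_llt0 ?subr_gt0// Gpos// gtr0_norm//; lra.
have Gl : G 0 < G (- t0).
  have mt0 : - t0 < 0 by rewrite oppr_lt0.
  have [c /andP[c0 ct] E] := MVT_derive mt0 (fun t => IG (- t0) 0 t Imt0 I0).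
  by rewrite -subr_lt0 E pmulr_llt0 ?subr_gt0// Gpos// ltr0_norm//; lra.
have cGv : {for 0, continuous (fun t => Gam (v t))}.
  have D := @is_derive1_comp _ Gam v 0 _ _ (dGam (v 0)) (is_derive_v (oI _ I0)).
  exact/differentiable_continuous/derivable1_diffP/ex_derive.
have [d2 /= d20 Hd2] : nbhs (0 : R) [set t | G t0 < Gam (v t) /\ Gam (v t) < G (- t0)].
  have n1 : nbhs (Gam (v 0)) [set x | G t0 < x] by apply: lt_nbhsr; rewrite -G0.
  have n2 : nbhs (Gam (v 0)) [set x | x < G (- t0)] by apply: lt_nbhsl; rewrite -G0.
  exact: filterI (cGv _ n1) (cGv _ n2).
exists (Num.min t0 d2); first by rewrite lt_min t00.
move=> sg /andP[sg0]; rewrite lt_min => /andP[sgt sgd].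
have sgd1 : `|sg| < d1 by exact: lt_trans t0d.
have [_ Isg] := near0 _ sgd1; split=> // t It vt; split.
  apply/eqP => t_eq0; rewrite {}t_eq0 in vt It.
  have dvI a b x : I a -> I b -> a <= x <= b -> is_derive x 1 v (v1 x).
    by move=> Ia Ib xab; apply: is_derive_v; apply: oI; apply: (iI Ia Ib).
  have [sg_lt|sg_gt|sgE] := ltgtP sg 0; last by rewrite sgE normr0 ltxx in sg0.
    have [c /andP[c0 ct] E] := MVT_derive sg_lt (fun x => dvI sg 0 x Isg I0).
    have cd : `|c| < d1 by apply: lt_trans sgd1; rewrite !ltr0_norm// ltrN2.
    have [/negP v1c _] := near0 _ cd; apply: v1c.
    by move/eqP: E; rewrite vt subrr eq_sym mulf_eq0 sub0r oppr_eq0 (lt_eqF sg_lt) orbF.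
  have [c /andP[c0 ct] E] := MVT_derive sg_gt (fun x => dvI 0 sg x I0 Isg).
  have cd : `|c| < d1 by apply: lt_trans sgd1; rewrite !gtr0_norm.
  have [/negP v1c _] := near0 _ cd; apply: v1c.
  by move/eqP: E; rewrite vt subrr eq_sym mulf_eq0 subr0 (gt_eqF sg_gt) orbF.
apply/eqP => v1t.
have GtE : G t = Gam (v sg) by rewrite /G v1t expr0n/= !mulr0 add0r vt.
have [l1 l2] : G t0 < Gam (v sg) /\ Gam (v sg) < G (- t0).
  by apply: Hd2; rewrite /ball /= sub0r normrN.
rewrite -GtE in l1 l2.
have [tt|tt] := leP t0 t; first by have := Gle _ _ It0 It tt; lra.
have [tt'|tt'] := leP t (- t0); first by have := Gle _ _ It Imt0 tt'; lra.
have : `|t| < d1 by apply: lt_trans t0d; rewrite ltr_norml tt' tt.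
by move=> /near0[]; rewrite v1t eqxx.
Qed.

End ReducedEquation.
(** * Composite functions *)

(** The chain rule for [v o phi] along a line on which [phi] is quadratic.  Only
    the derivative of [v] relative to [I] is needed, so the rule also holds where
    [phi z] is an endpoint of [I]. *)
Lemma derive_comp_line (R : realType) (m : nat) (phi u : 'rV[R]_m -> R)
    (Om : set 'rV[R]_m) (I : set R) (v : R -> R) (z w : 'rV[R]_m) (d a b : R) :
  open Om -> Om = phi @^-1` I -> (forall z, Om z -> u z = v (phi z)) -> Om z ->
  deriv_within I v (phi z) d ->
  (forall h, phi (h *: w + z) = phi z + h * a + h ^+ 2 * b) ->
  'D_w u z = d * a.
Proof.
move=> oOm OmE uE Oz dvz phiE.
apply: cvg_lim => //; apply/cvgrPdist_le => e e0.
set S := `|a| + `|b| + 1.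
have S0 : 0 < S by rewrite ltr_wpDl// addr_ge0.
set T := `|d| * `|b| + 1.
have T0 : 0 < T by rewrite ltr_wpDl// mulr_ge0.
have e'0 : 0 < e / 2 / S by rewrite !divr_gt0.
have [del del0 Hdel] := deriv_within_estimate dvz e'0.
have Onear : \forall h \near (0 : R), Om (h *: w + z).
  have c : {for 0, continuous (fun h : R => h *: w + z)}.
    by apply: cvgD; [exact: continuous_scalel|exact: cvg_cst].
  by apply: c; rewrite scale0r add0r; apply: open_nbhs_nbhs.
near=> h.
have h0 : h != 0 by near: h; exact: nbhs_dnbhs_neq.
have Oh : Om (h *: w + z) by near: h; exact: nbhs_dnbhs.
have : `|h| < Num.min 1 (Num.min (del / S) (e / 2 / T)).
  by near: h; apply: dnbhs0_lt; rewrite !lt_min ltr01 !divr_gt0.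
rewrite !lt_min => /and3P[h1]; rewrite !ltr_pdivlMr// => hS hT.
rewrite /= !uE// phiE; set D := h * a + h ^+ 2 * b.
have DE : phi z + h * a + h ^+ 2 * b = phi z + D by rewrite addrA.
have hn0 : 0 < `|h| by rewrite normr_gt0.
have DS : `|D| <= `|h| * S.
  rewrite /D expr2 -mulrA -mulrDr normrM ler_wpM2l//.
  apply: le_trans (ler_normD _ _) _; rewrite /S -addrA lerD2l normrM.
  have : `|h| * `|b| <= 1 * `|b| by rewrite ler_wpM2r// ltW.
  lra.
have ID : I (phi z + D) by move: Oh; rewrite OmE /= phiE DE.
have := Hdel _ ID; rewrite [_ + D - _]addrAC subrr add0r => /(_ (le_lt_trans DS hS)) est.
rewrite DE distrC.
have -> : h^-1 *: (v (phi z + D) - v (phi z)) - d * a =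
    h^-1 * (v (phi z + D) - v (phi z) - d * D) + d * b * h.
  by rewrite /D [_ *: _]mulrC; field.
apply: le_trans (ler_normD _ _) _.
have A1 : `|h^-1 * (v (phi z + D) - v (phi z) - d * D)| <= e / 2.
  rewrite normrM normfV mulrC ler_pdivrMr//; apply: le_trans est _.
  apply: le_trans (_ : e / 2 / S * (`|h| * S) <= _); first by rewrite ler_wpM2l// ltW.
  by rewrite mulrCA [_ * S]mulrC mulrC divfK ?gt_eqF// mulrC.
have A2 : `|d * b * h| <= e / 2.
  have : `|h| * (`|d| * `|b|) <= `|h| * T by rewrite ler_wpM2l// /T; lra.
  by rewrite !normrM [_ * `|h|]mulrC; lra.
have -> : e = e / 2 + e / 2 by field.
exact: lerD.
Unshelve. all: by end_near. Qed.

Lemma grad_eq0 (R : realType) (m s : nat) (u : 'rV[R]_m -> R) (z : 'rV[R]_m) :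
  grad s u z = 0 <-> forall i : 'I_m, 'D_(delta_mx 0 i) u z = 0.
Proof.
split=> [/rowP H i|H].
  by have /eqP := H i; rewrite !mxE mulf_eq0 signr_eq0 => /eqP.
by apply/rowP => i; rewrite !mxE H mulr0.
Qed.

(** The points of the closure of [I] that do not belong to [I]. *)
Definition boundary_value (R : realType) (I : set R) (t : R) : Prop :=
  ~ I t /\ forall e, 0 < e -> exists2 r, I r & `|r - t| < e.

(** An interval containing [0] has at most one boundary value on each side of
    [0]. *)
Lemma boundary_value_unique (R : realType) (I : set R) (t t' : R) :
  is_interval I -> I 0 -> boundary_value I t -> boundary_value I t' ->
  0 < t * t' -> t = t'.
Proof.
move=> iI I0.
have key x y : boundary_value I x -> boundary_value I y -> 0 < x * y -> ~ (`|x| < `|y|).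
  move=> [nx _] [_ ay] xy0 xy.
  have d0 : 0 < `|y| - `|x| by rewrite subr_gt0.
  have [r Ir ry] := ay _ d0; apply: nx.
  have [x0|x0|x0] := ltgtP x 0; last by rewrite x0 mul0r ltxx in xy0.
    have y0 : y < 0 by rewrite -(nmulr_rgt0 _ x0).
    apply: (iI r 0) => //; move: ry xy; rewrite (ltr0_norm x0) (ltr0_norm y0) ltr_norml => /andP[_ ry] _.
    by apply/andP; split; lra.
  have y0 : 0 < y by rewrite -(pmulr_rgt0 _ x0).
  apply: (iI 0 r) => //; move: ry xy; rewrite (gtr0_norm x0) (gtr0_norm y0) ltr_norml => /andP[ry _] _.
  by apply/andP; split; lra.
move=> bt bt' tt.
have [l|l|e] := ltgtP `|t| `|t'|.
- by case: (key _ _ bt bt' tt).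
- by rewrite mulrC in tt; case: (key _ _ bt' bt tt).
have [t0|t0|t0] := ltgtP t 0; last by rewrite t0 mul0r ltxx in tt.
  have t'0 : t' < 0 by rewrite -(nmulr_rgt0 _ t0).
  by move: e; rewrite !ltr0_norm// => /oppr_inj.
have t'0 : 0 < t' by rewrite -(pmulr_rgt0 _ t0).
by move: e; rewrite !gtr0_norm.
Qed.

(** Every point can be moved along a path on which [phi] is homogeneous of
    degree one. *)
Definition radial_lift (R : realType) (m : nat) (phi : 'rV[R]_m -> R) : Prop :=
  forall z, exists g : R -> 'rV[R]_m, [/\ continuous g, g 1 = z &
    forall t, 0 <= t -> phi (g t) = t * phi z].

Section CompositeDomain.
Context (R : realType) (m : nat) (phi u : 'rV[R]_m -> R) (Om : set 'rV[R]_m) (I : set R).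
Hypotheses (iI : is_interval I) (I0 : I 0) (Irange : I `<=` range phi).
Hypotheses (oOm : open Om) (OmE : Om = phi @^-1` I).
Hypotheses (cphi : continuous phi) (lift : radial_lift phi).

(** Since [Om] is open, lifting [t] to a radial path shows that [I] is open away
    from [0]; at [0] this also requires values of [phi] of both signs. *)
Lemma nbhs_off_zero t : I t -> t != 0 -> nbhs t I.
Proof.
move=> It t0; have [z _ zt] := Irange It.
have [g [cg g1 gphi]] := lift z.
have N1 : nbhs (1 : R) (fun x => 0 <= x /\ Om (g x)).
  apply: filterI; first by apply: lt_le_nbhsr; exact: ltr01.
  have Oz : Om z by rewrite OmE /= zt.
  by apply: cg; rewrite g1; exact: open_nbhs_nbhs.
have c : {for t, continuous (fun r : R => r / t)}.
  by apply: cvgM; [exact: cvg_id|exact: cvg_cst].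
have N1' : nbhs (t / t) (fun x => 0 <= x /\ Om (g x)) by rewrite divff.
have N2 : nbhs t (fun r => 0 <= r / t /\ Om (g (r / t))) := c _ N1'.
apply: filterS N2 => r [rt].
by rewrite OmE /= gphi// zt divfK.
Qed.

Lemma nbhs_zero z1 z2 : phi z1 < 0 -> 0 < phi z2 -> nbhs 0 I.
Proof.
have key z : exists2 t, 0 < t & I (t * phi z).
  have [g [cg g1 gphi]] := lift z.
  have N : nbhs (0 : R) (fun x => Om (g x)).
    apply: cg; apply: open_nbhs_nbhs; split=> //.
    by rewrite OmE /= gphi// mul0r.
  have [d /= d0 Hd] := N.
  exists (d / 2); first by rewrite divr_gt0.
  have dd : 0 <= d / 2 by rewrite ltW// divr_gt0.
  have : Om (g (d / 2)).
    by apply: Hd; rewrite /ball /= sub0r normrN ger0_norm//; lra.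
  by rewrite OmE /= gphi.
move=> p1 p2; have [t1 t10 I1] := key z1; have [t2 t20 I2] := key z2.
apply: (interval_nbhs iI I1 I2).
by rewrite pmulr_rlt0// p1 pmulr_rgt0.
Qed.

Lemma blowup_boundary z : blowup_set Om u z -> boundary_value I (phi z).
Proof.
move=> [cz nz _]; split; first by move: nz; rewrite OmE.
move=> e e0.
have [w []] := cz _ (cphi (nbhsx_ballx (phi z) e e0)).
by rewrite OmE /= => Iw; rewrite /ball /= distrC => we; exists (phi w).
Qed.

Lemma blowup_value t : abs_tends_as Om u phi (nbhs t) (pinfty_nbhs R) ->
  boundary_value I t.
Proof.
move=> [H1 H2]; split.
  move=> It; have [z _ zt] := Irange It.
  have [A tA HA] := H2 _ (nbhs_pinfty_gt (num_real `|u z|)).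
  have := HA z; rewrite OmE /= zt => /(_ It (nbhs_singleton tA)).
  by rewrite ltxx.
move=> e e0; have [z] := H1 _ (nbhsx_ballx t e e0).
by rewrite OmE /= => Iz; rewrite /ball /= distrC => h; exists (phi z).
Qed.

Lemma blowup_point t z : abs_tends_as Om u phi (nbhs t) (pinfty_nbhs R) ->
  phi z = t -> blowup_set Om u z.
Proof.
move=> Ht zt; have [nt ta] := blowup_value Ht.
have t0 : t != 0 by apply/eqP => t0; apply: nt; rewrite t0.
split; last first.
- move=> B; case: Ht => _ H2 /H2[A tA HA]; rewrite -zt in tA.
  have N : nbhs z (phi @^-1` A) := cphi tA.
  rewrite /fmap /within /=; apply: filterS N => w Aw Ow.
  exact: HA.
- by rewrite OmE /= zt.
have [g [cg g1 gphi]] := lift z.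
move=> N zN.
have : nbhs (1 : R) (fun x => N (g x)) by apply: cg; rewrite g1.
move=> [d /= d0 Hd].
pose x := Num.max 0 (1 - d / 2).
have x0 : 0 <= x by rewrite le_max lexx.
have x1 : x < 1 by rewrite gt_max ltr01 ltrBlDr ltrDl divr_gt0.
have xd : 1 - d / 2 <= x by rewrite le_max lexx orbT.
exists (g x); split; last first.
  by apply: Hd; rewrite /ball /= ltr_norml; apply/andP; split; lra.
rewrite OmE /= gphi// zt.
have e0 : 0 < (1 - x) * `|t| by rewrite mulr_gt0 ?subr_gt0 ?normr_gt0.
have [r Ir rt] := ta _ e0; move: rt; rewrite ltr_norml => /andP[r1 r2].
have [t_lt|t_gt|tE] := ltgtP t 0; last by rewrite tE eqxx in t0.
  move: r1 r2; rewrite ltr0_norm// => r1 r2.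
  apply: (iI Ir I0); apply/andP; split; first lra.
  by rewrite mulr_ge0_le0// ltW.
move: r1 r2; rewrite gtr0_norm// => r1 r2.
apply: (iI I0 Ir); apply/andP; split; last lra.
by rewrite mulr_ge0// ltW.
Qed.

End CompositeDomain.

Lemma abs_tends_scale (R : realType) (m : nat) (Om : set 'rV[R]_m)
    (u l : 'rV[R]_m -> R) (alpha r : R) (G : set_system R) : alpha != 0 ->
  abs_tends_as Om u l (nbhs r) G ->
  abs_tends_as Om u (fun z => alpha * l z) (nbhs (alpha * r)) G.
Proof.
move=> a0 [H1 H2]; split=> [A rA|B /H2[A rA HA]].
  have c : {for r, continuous (fun x => alpha * x)}.
    by apply: cvgM; [exact: cvg_cst|exact: cvg_id].
  by have [z Oz Az] := H1 _ (c _ rA); exists z.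
have c : {for alpha * r, continuous (fun x => alpha^-1 * x)}.
  by apply: cvgM; [exact: cvg_cst|exact: cvg_id].
have rA' : nbhs (alpha^-1 * (alpha * r)) A by rewrite mulKf.
exists ((fun x => alpha^-1 * x) @^-1` A); first exact: (c _ rA').
by move=> z Oz; rewrite /= mulKf// => /HA; apply.
Qed.
(** * The isoparametric functions *)

Lemma continuous_mull (R : realType) (T : topologicalType) (c : R) (f : T -> R)
    (z : T) : {for z, continuous f} -> {for z, continuous (fun w => c * f w)}.
Proof.
by move=> cf; apply: (@continuousM _ _ (fun=> c) f); [exact: cst_continuous|exact: cf].
Qed.

Section Isoparametric.
Context (R : realType) (m s k n : nat).
Hypotheses (hs : (1 <= s < m)%N) (hk : (k <= s)%N) (hn : (n <= m - s)%N).

Let s0 : (0 < s)%N. Proof. by case/andP: hs. Qed.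
Let sm : (s <= m)%N. Proof. by case/andP: hs => _ /ltnW. Qed.
Let km : (k <= m)%N. Proof. exact: leq_trans sm. Qed.
Let snm : (s + n <= m)%N. Proof. by rewrite -leq_subRL. Qed.

Let ellE' (z : 'rV[R]_m) : ell s k n z =
  - sqnorm_on (t_indices m k) z + sqnorm_on (x_indices m s n) z.
Proof. exact: ellE. Qed.

Lemma ell_scale (c : R) (z : 'rV[R]_m) : ell s k n (c *: z) = c ^+ 2 * ell s k n z.
Proof. by rewrite !ellE' !sqnorm_onZ; ring. Qed.

Lemma ell_continuous : continuous (fun z : 'rV[R]_m => ell s k n z).
Proof.
rewrite (_ : (fun z => _) = fun z : 'rV[R]_m =>
  - sqnorm_on (t_indices m k) z + sqnorm_on (x_indices m s n) z); last first.
  by apply/funext => z; exact: ellE'.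
move=> z; apply: (@continuousD _ _ _ (fun z => - sqnorm_on _ z)).
  by apply: continuousN; exact: sqnorm_on_continuous.
exact: sqnorm_on_continuous.
Qed.

Lemma ell_line_delta (z : 'rV[R]_m) (i : 'I_m) (h : R) :
  ell s k n (h *: delta_mx 0 i + z) = ell s k n z
   + h * (2 * ((i \in x_indices m s n)%:R - (i \in t_indices m k)%:R) * z 0 i)
   + h ^+ 2 * ((i \in x_indices m s n)%:R - (i \in t_indices m k)%:R).
Proof. by rewrite !ellE' !sqnorm_on_line !sum_delta !sqnorm_on_delta; ring. Qed.

(** The set where the gradient of [ell] vanishes. *)
Definition vertex : set 'rV[R]_m :=
  [set z | sqnorm_on (t_indices m k) z = 0 /\ sqnorm_on (x_indices m s n) z = 0].

Lemma vertexP (z : 'rV[R]_m) : vertex z <->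
  forall i, ((i \in x_indices m s n)%:R - (i \in t_indices m k)%:R) * z 0 i = 0.
Proof.
split=> [[/sqnorm_on_eq0 zt /sqnorm_on_eq0 zx] i|H].
  have [ix|ix] := boolP (i \in x_indices m s n); first by rewrite zx// mulr0.
  have [it|it] := boolP (i \in t_indices m k); first by rewrite zt// mulr0.
  by rewrite subrr mul0r.
have disj i : i \in t_indices m k -> i \in x_indices m s n = false.
  rewrite !inE => ik; apply/negP => /andP[si _].
  by have := leq_trans ik hk; rewrite ltnNge si.
split; apply/sqnorm_on_eq0 => i iP; have /eqP := H i.
  by rewrite iP disj// sub0r mulN1r oppr_eq0 => /eqP.
have -> : i \in t_indices m k = false.
  by apply/negP => /disj; rewrite iP.
by rewrite iP subr0 mul1r => /eqP.
Qed.

Lemma ell_vertex z : vertex z -> ell s k n z = 0.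
Proof. by move=> [zt zx]; rewrite ellE' zt zx oppr0 addr0. Qed.

Lemma vertex0 : vertex 0.
Proof. by split; exact: sqnorm_on0. Qed.

Lemma vertex_component : connected_component vertex 0 = vertex.
Proof.
apply: component_full => w [wt wx]; apply: segment_component => t _.
by rewrite subr0 addr0; split; rewrite sqnorm_onZ ?wt ?wx mulr0.
Qed.

Lemma minkl_continuous (a : 'rV[R]_m) : continuous (fun z => mink s a z).
Proof.
rewrite (_ : (fun z => _) = fun z : 'rV[R]_m =>
    \sum_(i < m) (-1) ^+ (i < s)%N * (a 0 i * z 0 i)); last first.
  by apply/funext => z; rewrite mink_sum.
apply: sum_continuous => i _ z.
have c0 : {for z, continuous (fun z : 'rV[R]_m => z 0 i)} by exact: coord_continuous.
exact: continuous_mull (continuous_mull c0).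
Qed.

Section OneFunction.
Context (phi : 'rV[R]_m -> R) (A : R -> R) (B : R).
Hypothesis iso : isoparametric s k n phi A B.

Lemma isoparametric0 : phi 0 = 0.
Proof.
case: iso => [a _ _|omega eps _ _ _ _|alpha _ _].
- by rewrite minkC -[X in mink _ X _](scale0r 0) minkZl mul0r mulr0.
- exact: parab0.
- by rewrite -[X in ell _ _ _ X](scale0r 0) ell_scale expr0n !mul0r mulr0.
Qed.

Lemma isoparametric_continuous : continuous phi.
Proof.
case: iso => [a _ _|omega eps _ _ _ _|alpha _ _] z.
- by apply: continuous_mull; exact: minkl_continuous.
- exact: parab_continuous.
- by apply: continuous_mull; exact: ell_continuous.
Qed.

Lemma isoparametric_coef (x : R) : 0 < x ->
  exists2 c : R, 0 < c & forall t, x <= `|t| -> c <= `|A t|.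
Proof.
move=> x0; case: iso => [a _ a0|omega eps _ _ /andP[om _] _|alpha _ al0].
- by exists `|4 * mink s a a| => //; rewrite normr_gt0 mulf_neq0.
- by exists `|4 * omega%:R| => //; rewrite normr_gt0 mulf_neq0// pnatr_eq0 -lt0n.
- exists (`|4 * alpha| * x) => [|t xt]; last by rewrite (normrM (4 * alpha)) ler_wpM2l.
  by rewrite mulr_gt0// normr_gt0 mulf_neq0.
Qed.

(** A translation direction permuting the fibres of [phi]. *)
Lemma isoparametric_unit_slope : (k + n = 0)%N ->
  exists d : 'rV[R]_m, forall z (h : R), phi (h *: d + z) = phi z + h.
Proof.
case: iso => [a _ a0|omega eps _ sms /andP[om _] _|alpha kn _] kn0.
- exists ((2 * mink s a a)^-1 *: a) => z h.
  by rewrite minkDr !minkZr; field.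
- have ssm : (s + s < m)%N by rewrite -ltn_subRL.
  exists (2^-1 *: delta_mx 0 (Ordinal ssm)) => z h.
  by rewrite scalerA parab_delta//; field.
- by rewrite kn0 in kn.
Qed.

Lemma isoparametric_quadratic : (0 < k + n)%N ->
  exists alpha, [/\ alpha != 0, phi = (fun z => alpha * ell s k n z),
    forall t, A t = 4 * alpha * t & B = 2 * (k + n)%:R * alpha].
Proof.
case: iso => [a kn0 _|omega eps kn0 _ _ _|alpha kn al0] kn'.
- by rewrite kn0 in kn'.
- by rewrite kn0 in kn'.
- by exists alpha.
Qed.

Lemma isoparametric_lift : radial_lift phi.
Proof.
have [kn|kn] := posnP (k + n).
  have [d Hd] := isoparametric_unit_slope kn.
  move=> z; exists (fun t => ((t - 1) * phi z) *: d + z); split.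
  - move=> t.
    have c : {for t, continuous (fun t : R => (t - 1) * phi z)}.
      apply: cvgM; last exact: cvg_cst.
      by apply: cvgB; [exact: cvg_id|exact: cvg_cst].
    by apply: cvgD; [exact: (continuous_scalel c)|exact: cvg_cst].
  - by rewrite subrr mul0r scale0r add0r.
  - by move=> t _; rewrite Hd; ring.
have [alpha [al0 -> _ _]] := isoparametric_quadratic kn.
move=> z; exists (fun t => Num.sqrt t *: z); split.
- by move=> t; apply: continuous_scalel; exact: sqrt_continuous.
- by rewrite sqrtr1 scale1r.
- by move=> t t0; rewrite ell_scale sqr_sqrtr//; ring.
Qed.

Lemma isoparametric_line (z : 'rV[R]_m) (i : 'I_m) :
  exists a b, forall h, phi (h *: delta_mx 0 i + z) = phi z + h * a + h ^+ 2 * b.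
Proof.
case: iso => [a _ _|omega eps _ _ _ _|alpha _ _].
- exists (2 * mink s a (delta_mx 0 i)), 0 => h.
  by rewrite minkDr minkZr; ring.
- by eexists; eexists => h; exact: parab_line.
- pose c : R := (i \in x_indices m s n)%:R - (i \in t_indices m k)%:R.
  exists (alpha * (2 * c * z 0 i)), (alpha * c) => h.
  by rewrite ell_line_delta -/c; ring.
Qed.

(** The planar and the parabolic functions have no critical point. *)
Lemma isoparametric_regular (z : 'rV[R]_m) : (k + n = 0)%N ->
  exists i a b, a != 0 /\
    forall h, phi (h *: delta_mx 0 i + z) = phi z + h * a + h ^+ 2 * b.
Proof.
case: iso => [a _ a0|omega eps _ sms /andP[om _] _|alpha kn _] kn0.
- have [i ai] : exists i : 'I_m, a 0 i != 0.
    apply/existsP; apply: contraNT a0; rewrite negb_exists => /forallP H.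
    rewrite mink_sum// big1// => i _.
    by have := H i; rewrite negbK => /eqP ->; rewrite !mul0r mulr0.
  exists i, (2 * mink s a (delta_mx 0 i)), 0; split.
    by rewrite mulf_neq0// mink_delta// mulf_neq0// signr_eq0.
  by move=> h; rewrite minkDr minkZr; ring.
- have ssm : (s + s < m)%N by rewrite -ltn_subRL.
  exists (Ordinal ssm), 2, 0; split => // h.
  by rewrite parab_delta//; ring.
- by rewrite kn0 in kn.
Qed.

End OneFunction.

(** * The fibres when one of [k] and [n] vanishes *)

(** The component of a cylinder over a sphere in [l] variables, which is a
    hyperplane if [l = 1]. *)
Lemma sphere_fibre (a l : nat) (z : 'rV[R]_m) : (a + l <= m)%N -> (0 < l)%N ->
  sqnorm_on (x_indices m a l) z != 0 ->
  homothetic s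
    (connected_component [set w | sqnorm_on (x_indices m a l) w =
                                  sqnorm_on (x_indices m a l) z] z)
    [set w | sqnorm_on (x_indices m a l) w = (l != 1%N)%:R].
Proof.
move=> alm l0 z0; have [l1|l1] := eqVneq l 1%N.
  rewrite {}l1 in alm z0 *; rewrite addn1 in alm.
  rewrite (@x_indices1 m a (Ordinal alm))//.
  have -> : [set w : 'rV[R]_m | sqnorm_on (finset.set1 (Ordinal alm)) w =
      sqnorm_on (finset.set1 (Ordinal alm)) z] =
      [set w | w 0 (Ordinal alm) ^+ 2 = z 0 (Ordinal alm) ^+ 2].
    by apply/seteqP; split=> w /=; rewrite !sqnorm_on1.
  rewrite square_fibre_component//; apply: (@homothetic_shift _ _ _ z) => w.
  rewrite /= sqnorm_on1 mxE; split=> [/eqP|/eqP].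
    by rewrite -subr_eq0 addrK => /eqP ->; rewrite expr0n.
  by rewrite sqrf_eq0 => /eqP ->; rewrite add0r.
have l2 : (1 < l)%N by case: l l0 l1 {alm z0} => [|[]].
set r := sqnorm_on _ z in z0 *.
have r0 : 0 < r by rewrite lt_neqAle eq_sym z0 sqnorm_on_ge0.
rewrite component_fullT//; last first.
  by move=> x y xr yr; apply: sphere_component => //; exact: x_indices_gt1.
apply: (@homothetic_scale _ _ _ (Num.sqrt r)); first by rewrite sqrtr_gt0.
move=> w /=; rewrite sqnorm_onZ sqr_sqrtr ?ltW//; split=> [|->]; last by rewrite mulr1.
by rewrite -[RHS]mulr1 => /(mulfI z0).
Qed.

Lemma ell_x (z : 'rV[R]_m) : k = 0%N -> ell s k n z = sqnorm_on (x_indices m s n) z.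
Proof.
move=> k0; rewrite ellE' t_indicesE k0 x_indices0.
by rewrite [X in - X]/sqnorm_on big_set0 oppr0 add0r.
Qed.

Lemma ell_t (z : 'rV[R]_m) : n = 0%N -> ell s k n z = - sqnorm_on (x_indices m 0 k) z.
Proof.
move=> n0; rewrite ellE' t_indicesE n0 x_indices0.
by rewrite [X in _ + X]/sqnorm_on big_set0 addr0.
Qed.

(** The components of all the regular fibres are homothetic to the model [M]
    bearing the name [o], and only compatible names apply to [M]. *)
Definition regular_fibres_model (phi : 'rV[R]_m -> R) (o : option_name)
    (M : set 'rV[R]_m) : Prop :=
  [/\ model s k n o M,
      forall z, (k + n = 0)%N \/ phi z != 0 ->
        homothetic s (connected_component [set w | phi w = phi z] z) M &
      forall o' M', model s k n o' M' -> homothetic s M M' -> compatible o o'].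

Lemma fibres_model_flat (phi : 'rV[R]_m -> R) (A : R -> R) (B : R) :
  isoparametric s k n phi A B -> (k + n = 0)%N ->
  exists o M, (o = Hyperplane_a \/ o = Parabolic) /\ regular_fibres_model phi o M.
Proof.
move=> iso kn0; have [d Hd] := isoparametric_unit_slope iso kn0.
have shift z : homothetic s [set w | phi w = phi z] [set w | phi w = 0].
  apply: (@homothetic_shift _ _ _ (phi z *: d)) => w /=.
  rewrite addrC Hd; split=> [/eqP|->]; last by rewrite add0r.
  by rewrite -subr_eq0 addrK => /eqP.
have k0 : k = 0%N by apply/eqP; move/eqP: kn0; rewrite addn_eq0 => /andP[].
have n0 : n = 0%N by apply/eqP; move/eqP: kn0; rewrite addn_eq0 => /andP[].
case: iso Hd shift => [a _ a0|omega eps _ sms om eps1|alpha kn _] Hd shift.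
- exists Hyperplane_a, [set w | mink s a w = 0]; split; first by left.
  have ME : [set w | 2 * mink s a w = 0] = [set w | mink s a w = 0].
    apply/seteqP; split=> w /= => [/eqP|->]; last by rewrite mulr0.
    by rewrite mulf_eq0 pnatr_eq0 => /eqP.
  have aN0 : a != 0.
    by apply: contraNneq a0 => ->; rewrite -[X in mink _ X _](scale0r 0) minkZl mul0r.
  split; first by exists a.
    move=> z _; rewrite -ME component_fullT//= => x y xz yz.
    apply: segment_component => t _ /=.
    have xz' : mink s a x = mink s a z by move: xz => /=; lra.
    have yz' : mink s a y = mink s a z by move: yz => /=; lra.
    by rewrite minkDr minkZr minkDr minkNr xz' yz'; ring.
  move=> o' M' HM' MM'.
  have [||->|[->|->]] // := compatible_planar s0 sm km snm _ _ HM' MM'.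
    have := @model_shape _ _ _ k n Hyperplane_a [set w | mink s a w = 0] s0 km snm.
    by apply; exists a.
  by exists 0; rewrite /= minkC -[X in mink _ X _](scale0r 0) minkZl mul0r.
- have /andP[om1 _] := om.
  have HM : model s k n Parabolic [set w : 'rV[R]_m | parab s omega eps w = 0].
    by exists omega, eps, 0; rewrite parabolic_modelE.
  exists Parabolic, [set w | parab s omega eps w = 0]; split; first by right.
  split=> //.
    move=> z _; rewrite component_fullT//= => x y xz yz.
    exact: parabolic_component.
  move=> o' M' HM' MM'.
  have [nc _] := model_shape s0 km snm HM.
  have M'nc : ~ midpoint_convex M'.
    by move=> M'c; apply: nc; apply: homothetic_midpoint (homothetic_sym MM') M'c.
  have M'0 : M' !=set0.
    by apply: (homothetic_nonempty MM'); exact: parabolic_nonempty.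
  have := model_shape s0 km snm HM'.
  by case: o' HM' => //= _; rewrite ?k0 ?n0.
- by rewrite kn0 in kn.
Qed.

End Isoparametric.
Section QuadraticFibres.
Context (R : realType) (m s k n : nat).
Hypotheses (hs : (1 <= s < m)%N) (hk : (k <= s)%N) (hn : (n <= m - s)%N).

Let s0 : (0 < s)%N. Proof. by case/andP: hs. Qed.
Let sltm : (s < m)%N. Proof. by case/andP: hs. Qed.
Let sm : (s <= m)%N. Proof. exact: ltnW. Qed.
Let km : (k <= m)%N. Proof. exact: leq_trans sm. Qed.
Let snm : (s + n <= m)%N. Proof. by rewrite -leq_subRL. Qed.
Let m0 : (0 < m)%N. Proof. exact: leq_trans sltm. Qed.

Let it : 'I_m := Ordinal m0.
Let ix : 'I_m := Ordinal sltm.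

Lemma flat_x1E : flat_x s 1 = [set z : 'rV[R]_m | z 0 ix = 0].
Proof.
rewrite flat_xE (@x_indices1 m s ix)//; apply/seteqP; split=> z /=.
  by rewrite sqnorm_on1 => /eqP; rewrite sqrf_eq0 => /eqP.
by rewrite sqnorm_on1 => ->; rewrite expr0n.
Qed.

Lemma flat_t1E : @flat_t R m 1 = [set z : 'rV[R]_m | z 0 it = 0].
Proof.
rewrite flat_tE t_indicesE (@x_indices1 m 0 it)//; apply/seteqP; split=> z /=.
  by rewrite sqnorm_on1 => /eqP; rewrite sqrf_eq0 => /eqP.
by rewrite sqnorm_on1 => ->; rewrite expr0n.
Qed.

(** A cylinder over a sphere is centrally symmetric and not midpoint convex, which
    leaves only the names of nonempty spherical models. *)
Lemma compatible_sphere (P : {set 'I_m}) o (M' : set 'rV[R]_m) : (0 < #|P|)%N ->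
  model s k n o M' -> homothetic s [set z | sqnorm_on P z = 1] M' ->
  (o = Flat_x_Sphere /\ n != 0%N) \/ (o = Sphere_x_Flat /\ k != 0%N).
Proof.
move=> P0 HM' MM'.
have M'nc : ~ midpoint_convex M'.
  move=> /(homothetic_midpoint sm (homothetic_sym MM')).
  exact: sphere_not_midpoint_convex.
have M's : point_symmetric M'.
  by apply: homothetic_symmetric (homothetic_sym MM') _ => //; exact: sphere_symmetric.
have M'0 : M' !=set0 by apply: homothetic_nonempty MM' _; exact: sphere_nonempty.
have := model_shape s0 km snm HM'; case: o HM' => //= _.
- by case.
- by case: n => // n' _; left.
- by case: k => // k' _; right.
Qed.

(** A coordinate hyperplane bears the name [Flat_s] or [Flat_s1] according to the
    character of its axis, but not both. *)
Lemma flat_compatible o (M M' : set 'rV[R]_m) : M = flat_x s 1 \/ M = @flat_t R m 1 ->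
  model s k n o M' -> homothetic s M M' ->
  compatible (if `[< M = flat_x s 1 >] then Flat_s else Flat_s1) o.
Proof.
move=> HM HM' MM'.
have Mc : midpoint_convex M.
  case: HM => ->.
    exact: (@model_shape R m s k n Flat_s _ s0 km snm).
  exact: (@model_shape R m s k n Flat_s1 _ s0 km snm).
have M0 : M !=set0 by case: HM => ->; exists 0 => i _; rewrite ?/xc tc0.
have ij : (ix < s)%N != (it < s)%N by rewrite /= ltnn s0.
have ji : (it < s)%N != (ix < s)%N by rewrite /= ltnn s0.
have := compatible_planar s0 sm km snm Mc M0 HM' MM'.
case: asboolP => E [Ho|[Ho|Ho]]; rewrite Ho // in HM' *.
  move: MM'; rewrite E HM' flat_x1E flat_t1E.
  by move=> /(coordinate_hyperplanes_not_homothetic sm ij).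
move: MM'; case: HM => [//|->]; rewrite HM' flat_x1E flat_t1E.
by move=> /(coordinate_hyperplanes_not_homothetic sm ji).
Qed.

Lemma fibres_model_quadratic (phi : 'rV[R]_m -> R) (A : R -> R) (B : R) :
  isoparametric s k n phi A B -> (0 < k + n)%N -> k = 0%N \/ n = 0%N ->
  exists o M,
    (o = Flat_s \/ o = Flat_s1 \/ o = Flat_x_Sphere \/ o = Sphere_x_Flat) /\
    regular_fibres_model s k n phi o M.
Proof.
move=> iso kn0 kn; have [al [al0 phiE _ _]] := isoparametric_quadratic iso kn0.
have alI x y : al * x = al * y -> x = y by exact: mulfI.
case: kn => [k0|n0].
  have n0 : (0 < n)%N by rewrite k0 in kn0.
  have fibE z : [set w | phi w = phi z] = [set w | sqnorm_on (x_indices m s n) w =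
      sqnorm_on (x_indices m s n) z].
    by apply/seteqP; split=> w /=; rewrite phiE !ell_x//; [move=> /alI|move=> ->].
  have phi0 z : phi z != 0 -> sqnorm_on (x_indices m s n) z != 0.
    by rewrite phiE ell_x// mulf_eq0 negb_or => /andP[].
  have hom z : (k + n = 0)%N \/ phi z != 0 ->
      homothetic s (connected_component [set w | phi w = phi z] z)
        [set w | sqnorm_on (x_indices m s n) w = (n != 1%N)%:R].
    move=> [kn|/phi0 z0]; first by rewrite kn in kn0.
    by rewrite fibE; exact: sphere_fibre.
  have [n1|n1] := eqVneq n 1%N.
    exists Flat_s, (flat_x s 1); split; first by left.
    split=> //; first by move=> z /hom; rewrite n1 eqxx flat_xE.
    move=> o' M' HM' MM'; have := flat_compatible (or_introl erefl) HM' MM'.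
    by rewrite asboolT.
  exists Flat_x_Sphere, [set w | sqnorm_on (x_indices m s n) w = 1]; split; first by auto.
  split; first by rewrite /= sphere_x_modelE.
    by move=> z /hom; rewrite n1.
  move=> o' M' HM' MM'.
  by have [[->//]|[_]] := compatible_sphere (x_indices_gt0 snm n0) HM' MM'; rewrite k0.
have k0 : (0 < k)%N by rewrite n0 addn0 in kn0.
have fibE z : [set w | phi w = phi z] = [set w | sqnorm_on (x_indices m 0 k) w =
    sqnorm_on (x_indices m 0 k) z].
  by apply/seteqP; split=> w /=; rewrite phiE !ell_t//; [move=> /alI/oppr_inj|move=> ->].
have phi0 z : phi z != 0 -> sqnorm_on (x_indices m 0 k) z != 0.
  by rewrite phiE ell_t// mulf_eq0 oppr_eq0 negb_or => /andP[].
have hom z : (k + n = 0)%N \/ phi z != 0 ->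
    homothetic s (connected_component [set w | phi w = phi z] z)
      [set w | sqnorm_on (x_indices m 0 k) w = (k != 1%N)%:R].
  move=> [kn|/phi0 z0]; first by rewrite kn in kn0.
  by rewrite fibE; exact: sphere_fibre.
have [k1|k1] := eqVneq k 1%N.
  exists Flat_s1, (@flat_t R m 1); split; first by auto.
  split=> //; first by move=> z /hom; rewrite k1 eqxx flat_tE t_indicesE.
  move=> o' M' HM' MM'; have := flat_compatible (or_intror erefl) HM' MM'.
  case: asboolP => // E.
  have ij : (it < s)%N != (ix < s)%N by rewrite /= ltnn s0.
  have [] : ~ homothetic s (@flat_t R m 1) (flat_x s 1).
    by rewrite flat_t1E flat_x1E; exact: coordinate_hyperplanes_not_homothetic.
  by rewrite -E; exact: homothetic_refl.
exists Sphere_x_Flat, [set w | sqnorm_on (x_indices m 0 k) w = 1]; split; first by auto.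
split; first by rewrite /= sphere_t_modelE// t_indicesE.
  by move=> z /hom; rewrite k1.
move=> o' M' HM' MM'.
by have [[_]|[->//]] := compatible_sphere (x_indices_gt0 (s := 0) km k0) HM' MM'; rewrite n0.
Qed.

(** If [k = 0] or [n = 0], the zero set of the gradient of [ell] is the focal
    variety. *)
Lemma vertex_focal : (0 < k + n)%N -> k = 0%N \/ n = 0%N ->
  focal s k n (@vertex R m s k n).
Proof.
have empty : @sqnorm_on R m finset.set0 = fun=> 0.
  by apply/funext => z; rewrite /sqnorm_on big_set0.
move=> kn0 [k0|n0].
  right; split; first by rewrite k0 in kn0.
  rewrite flat_xE /vertex t_indicesE k0 x_indices0 empty.
  by apply/seteqP; split=> z //= [].
left; split; first by rewrite n0 addn0 in kn0.
rewrite flat_tE /vertex n0 x_indices0 empty.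
by apply/seteqP; split=> z //= [].
Qed.

End QuadraticFibres.
(** * Level sets, critical set and blow-up of a solution *)

Section Solution.
Context (R : realType) (m s k n : nat).
Hypotheses (hs : (1 <= s < m)%N) (hk : (k <= s)%N) (hn : (n <= m - s)%N).
Context (p mu : R) (p1 : 1 < p) (mu0 : mu != 0).
Context (Om : set 'rV[R]_m) (u phi : 'rV[R]_m -> R) (A : R -> R) (B : R)
  (I : set R) (v v1 v2 : R -> R).
Hypotheses (iso : isoparametric s k n phi A B) (iI : is_interval I) (I0 : I 0)
  (Irange : I `<=` range phi).
Hypotheses (dv : forall t, I t -> deriv_within I v t (v1 t))
  (dv1 : forall t, I t -> deriv_within I v1 t (v2 t))
  (ode : forall t, I t -> A t * v2 t + B * v1 t = - mu * `|v t| `^ (p - 1) * v t)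
  (v0 : 0 < v 0).
Hypotheses (OmE : Om = phi @^-1` I) (uE : forall z, Om z -> u z = v (phi z))
  (oOm : open Om).

Let sm : (s <= m)%N. Proof. by case/andP: hs => _ /ltnW. Qed.
Let cphi : continuous phi := isoparametric_continuous hs hk hn iso.
Let lift : radial_lift phi := isoparametric_lift hs hk hn iso.
Let phi0 : phi 0 = 0 := isoparametric0 hs hk hn iso.
Let A_gt := isoparametric_coef iso.
Let crit := critical_set s Om u.
Let fibre z := [set w | phi w = phi z].

Let Om0 : Om 0. Proof. by rewrite OmE /= phi0. Qed.

Let OmP z : Om z <-> I (phi z). Proof. by rewrite OmE. Qed.

Lemma partial_comp z i a b : Om z ->
  (forall h, phi (h *: delta_mx 0 i + z) = phi z + h * a + h ^+ 2 * b) ->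
  'D_(delta_mx 0 i) u z = v1 (phi z) * a.
Proof.
by move=> Oz Hl; apply: (derive_comp_line oOm OmE uE Oz _ Hl); apply: dv; apply/OmP.
Qed.

Lemma critical_of_v1 z : Om z -> v1 (phi z) = 0 -> grad s u z = 0.
Proof.
move=> Oz v1z; apply/grad_eq0 => i.
have [a [b Hl]] := isoparametric_line hs hk hn iso z i.
by rewrite (partial_comp Oz Hl) v1z mul0r.
Qed.

Lemma critical_flatP z : (k + n = 0)%N -> Om z -> (grad s u z = 0 <-> v1 (phi z) = 0).
Proof.
move=> kn Oz; split; last exact: critical_of_v1.
move=> /grad_eq0 H; have [i [a [b [a0 Hl]]]] := isoparametric_regular hs iso z kn.
by have /eqP := H i; rewrite (partial_comp Oz Hl) mulf_eq0 (negbTE a0) orbF => /eqP.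
Qed.

Lemma critical_quadraticP z : (0 < k + n)%N -> Om z ->
  (grad s u z = 0 <-> v1 (phi z) = 0 \/ vertex s k n z).
Proof.
move=> kn Oz; have [al [al0 phiE _ _]] := isoparametric_quadratic iso kn.
pose c (i : 'I_m) : R := (i \in x_indices m s n)%:R - (i \in t_indices m k)%:R.
have DE i : 'D_(delta_mx 0 i) u z = v1 (phi z) * (2 * al * (c i * z 0 i)).
  apply: (partial_comp (b := al * c i)) => // h.
  by rewrite phiE (ell_line_delta hs hk hn) -/(c i); ring.
split=> [/grad_eq0 H|[|/(@vertexP R m s k n hk _) Hv]]; last 2 first.
- exact: critical_of_v1.
- by apply/grad_eq0 => i; rewrite DE Hv !mulr0.
have [->|v1z] := eqVneq (v1 (phi z)) 0; first by left.
right; apply/(@vertexP R m s k n hk _) => i; have /eqP := H i.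
rewrite DE !mulf_eq0 (negbTE v1z) (negbTE al0) pnatr_eq0/= -mulf_eq0.
by move=> /eqP.
Qed.

Lemma level_component c z : Om z -> u z = c ->
  connected_component [set w | Om w /\ u w = c] z = connected_component (fibre z) z.
Proof.
move=> Oz uz.
have free : interval_free [set t | I t /\ v t = c].
  exact: (level_interval_free p1 mu0 iI I0 dv dv1 ode A_gt v0).
rewrite (component_in_fibre cphi free)//.
  congr (connected_component _ z); apply/seteqP; split=> [w []//|w /= wz].
  have Ow : Om w by apply/OmP; rewrite wz; apply/OmP.
  by split=> //; split=> //; rewrite uE// wz -uE.
by move=> w [Ow uw]; split; [apply/OmP|rewrite -uE].
Qed.

Lemma regular_component_fibre S : regular_component s Om u S ->
  exists z, [/\ Om z, S = connected_component (fibre z) z &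
    (k + n = 0)%N \/ phi z != 0].
Proof.
move=> [c [reg [z [Oz uz] ->]]]; exists z; split=> //; first exact: level_component.
have [kn|kn] := posnP (k + n); [by left|right].
apply/eqP => z0; have vc : v 0 = c by rewrite -z0 -uE.
case: reg => [reg|c0]; last by move: v0; rewrite vc c0 ltxx.
apply: (reg 0) => //; first by rewrite uE// phi0.
by apply/critical_quadraticP => //; right; exact: vertex0.
Qed.

(** The leading coefficient vanishes at [0], where the equation determines the
    derivative of [v]. *)
Lemma v1_at_zero : (0 < k + n)%N -> v1 0 != 0.
Proof.
move=> kn; have [al [al0 _ AE BE]] := isoparametric_quadratic iso kn.
apply/eqP => v10; have /eqP := ode I0.
rewrite AE mulr0 mul0r v10 mulr0 addr0 eq_sym !mulf_eq0 oppr_eq0 (negbTE mu0)/=.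
by rewrite powR_eq0 normr_eq0 (gt_eqF v0).
Qed.

(** A component of the critical set is a component of a fibre, or it is the whole
    critical set of the isoparametric function. *)
Lemma critical_component_cases V : is_component crit V ->
  (exists z, [/\ Om z, V = connected_component (fibre z) z &
     (k + n = 0)%N \/ phi z != 0]) \/
  ((0 < k + n)%N /\ V = vertex s k n).
Proof.
move=> [z cz ->]; have [Oz gz] := cz.
have free : interval_free [set t | I t /\ (t = 0 \/ v1 t = 0)].
  exact: (critical_interval_free p1 mu0 iI I0 dv dv1 ode A_gt v0).
have critZ w : crit w -> I (phi w) /\ (phi w = 0 \/ v1 (phi w) = 0).
  move=> [Ow gw]; split; first exact/OmP.
  have [kn|kn] := posnP (k + n); first by right; apply/critical_flatP.
  have /critical_quadraticP[//|//|v1w|vw] := gw; first by right.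
  left; have [al [_ -> _ _]] := isoparametric_quadratic iso kn.
  by rewrite (ell_vertex hs hk hn vw) mulr0.
rewrite (component_in_fibre cphi free critZ cz).
have Ofib w : fibre z w -> Om w by move=> wz; apply/OmP; rewrite wz; apply/OmP.
have full : v1 (phi z) = 0 -> crit `&` fibre z = fibre z.
  move=> v1z; apply/seteqP; split=> [w []//|w wz]; split=> //; split; first exact: Ofib.
  by apply: critical_of_v1; [exact: Ofib|rewrite wz].
have [kn|kn] := posnP (k + n).
  left; exists z; split=> //; last by left.
  by rewrite full//; apply/critical_flatP.
have [z0|z0] := eqVneq (phi z) 0; last first.
  left; exists z; split=> //; last by right.
  by rewrite full//; case: (critZ z cz) => _ [/eqP|//]; rewrite (negbTE z0).
right; split=> //.
have -> : crit `&` fibre z = vertex s k n.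
  have [al [_ phiE _ _]] := isoparametric_quadratic iso kn.
  apply/seteqP; split=> [w [[Ow gw] wz]|w vw].
    have /critical_quadraticP[//|//|v1w|//] := gw.
    by have /eqP[] := v1_at_zero kn; rewrite -[X in v1 X]z0 -wz.
  have w0 : phi w = 0 by rewrite phiE (ell_vertex hs hk hn vw) mulr0.
  split; last by rewrite /fibre /= w0 z0.
  have Ow : Om w by apply/OmP; rewrite w0.
  by split=> //; apply/critical_quadraticP => //; right.
have zv : vertex s k n z.
  have /critical_quadraticP[//|//|v1z|//] := gz.
  by have /eqP[] := v1_at_zero kn; rewrite -[X in v1 X]z0.
rewrite -[RHS](vertex_component R m s k n); apply: esym; apply: same_connected_component.
by rewrite vertex_component.
Qed.

(** The components of the blow-up set, when it is a union of at most two
    fibres. *)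
Lemma blowup_components t1 t2 :
  abs_tends_as Om u phi (nbhs t1) (pinfty_nbhs R) ->
  abs_tends_as Om u phi (nbhs t2) (pinfty_nbhs R) ->
  (forall z, boundary_value I (phi z) -> 0 < phi z * t1 \/ 0 < phi z * t2) ->
  (forall z, phi z = t1 -> blowup_set Om u z) /\
  (forall C, is_component (blowup_set Om u) C ->
     exists z, [/\ phi z = t1 \/ phi z = t2, phi z != 0 &
        C = connected_component (fibre z) z]).
Proof.
move=> H1 H2 bnd.
have b1 := blowup_value Irange OmE H1; have b2 := blowup_value Irange OmE H2.
have bp t w : abs_tends_as Om u phi (nbhs t) (pinfty_nbhs R) -> phi w = t ->
    blowup_set Om u w by exact: (blowup_point iI I0 Irange OmE cphi lift).
split; first by move=> z; exact: bp.
have val z : blowup_set Om u z -> phi z = t1 \/ phi z = t2.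
  move=> /(blowup_boundary OmE cphi) bz.
  have [l|l] := bnd _ bz; [left|right].
    exact: (boundary_value_unique iI I0 bz b1 l).
  exact: (boundary_value_unique iI I0 bz b2 l).
move=> C [z bz ->]; exists z; split; first exact: val.
  by apply/eqP => z0; case: bz => _ + _; apply; apply/OmP; rewrite z0.
have free : interval_free [set t : R | t = t1 \/ t = t2].
  move=> a b ab Hab.
  have Ha : a = t1 \/ a = t2 by apply: Hab; rewrite lexx ltW.
  have Hb : b = t1 \/ b = t2 by apply: Hab; rewrite lexx ltW.
  have Hm : (a + b) / 2 = t1 \/ (a + b) / 2 = t2 by apply: Hab; apply/andP; split; lra.
  by case: Ha => ?; case: Hb => ?; case: Hm => ?; lra.
rewrite (component_in_fibre cphi free val bz).
congr (connected_component _ z); apply/seteqP; split=> [w []//|w wz]; split=> //.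
by case: (val z bz) => zt; [apply: (bp _ _ H1)|apply: (bp _ _ H2)]; rewrite -zt.
Qed.

(** * Solutions with [k = 0] or [n = 0] *)

Section Definite.
Hypothesis kn : k = 0%N \/ n = 0%N.

Lemma fibres_model : exists o M,
  [/\ regular_fibres_model s k n phi o M,
      (k + n = 0)%N -> o = Hyperplane_a \/ o = Parabolic &
      (0 < k + n)%N ->
        o = Flat_s \/ o = Flat_s1 \/ o = Flat_x_Sphere \/ o = Sphere_x_Flat].
Proof.
have [kn0|kn0] := posnP (k + n).
  by have [opt [M [Ho HM]]] := fibres_model_flat hs hk hn iso kn0; exists opt, M; split.
have [opt [M [Ho HM]]] := fibres_model_quadratic hs hk hn iso kn0 kn.
exists opt, M; split=> //.
by move=> E; move: kn0; rewrite E.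
Qed.

Lemma homothetic_fibres z w : (k + n = 0)%N \/ phi z != 0 -> (k + n = 0)%N \/ phi w != 0 ->
  homothetic s (connected_component (fibre z) z) (connected_component (fibre w) w).
Proof.
move=> Hz Hw; have [opt [M [[_ H _] _ _]]] := fibres_model.
by apply: homothetic_trans (H _ Hz) _; exact/homothetic_sym/H.
Qed.

(** The description of level sets and of the critical set, for any list of names
    containing those that can occur. *)
Lemma level_and_critical_sets (opts : set option_name) :
  ((k + n = 0)%N -> opts Hyperplane_a /\ opts Parabolic) ->
  [/\ opts Flat_s, opts Flat_s1, opts Flat_x_Sphere & opts Sphere_x_Flat] ->
  exactly_one_option s k n Om u opts /\
  (forall V, is_component crit V -> model_or_focal s k n opts V).
Proof.
move=> opts0 [of1 of2 of3 of4]; have [opt [M [[HM H HU] o0 o1]]] := fibres_model.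
have oo : opts opt.
  have [kn0|kn0] := posnP (k + n).
    by have [q2 q3] := opts0 kn0; case: (o0 kn0) => ->.
  by case: (o1 kn0) => [->|[->|[->|->]]].
split.
  exists opt, M; split=> //.
    by move=> S /regular_component_fibre[z [_ -> Hz]]; exact: H.
  move=> o' M' S _ HM' /regular_component_fibre[z [_ -> Hz]] SM'.
  by apply: HU HM' _; apply: homothetic_trans SM'; exact/homothetic_sym/H.
move=> V /critical_component_cases[[z [_ -> Hz]]|[kn0 ->]].
  by left; exists opt, M; split=> //; exact: H.
right; exists (@vertex R m s k n); first exact: vertex_focal.
exact: homothetic_refl.
Qed.

Lemma blowup_homothetic_regular t1 t2 :
  abs_tends_as Om u phi (nbhs t1) (pinfty_nbhs R) ->
  abs_tends_as Om u phi (nbhs t2) (pinfty_nbhs R) ->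
  (forall z, boundary_value I (phi z) -> 0 < phi z * t1 \/ 0 < phi z * t2) ->
  (exists z, phi z = t1) ->
  blowup_set Om u !=set0 /\
  (forall C S, is_component (blowup_set Om u) C -> regular_component s Om u S ->
     homothetic s C S).
Proof.
move=> H1 H2 bnd [z0 z0t]; have [ne comp] := blowup_components H1 H2 bnd.
split; first by exists z0; exact: ne.
move=> C S /comp[z [_ z0' ->]] /regular_component_fibre[w [_ -> Hw]].
by apply: homothetic_fibres => //; right.
Qed.

Lemma blowup_definite (r : R) : 0 < r ->
  (k = 0%N -> (0 < n)%N -> abs_tends_as Om u (ell s 0 n) (nbhs r) (pinfty_nbhs R)) ->
  (n = 0%N -> (0 < k)%N -> abs_tends_as Om u (ell s k 0) (nbhs (- r)) (pinfty_nbhs R)) ->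
  ((k + n = 0)%N -> abs_tends_as Om u phi (nbhs r) (pinfty_nbhs R) /\
                    abs_tends_as Om u phi (nbhs (- r)) (pinfty_nbhs R)) ->
  blowup_set Om u !=set0 /\
  (forall C S, is_component (blowup_set Om u) C -> regular_component s Om u S ->
     homothetic s C S).
Proof.
move=> r0 Hx Ht Hf.
have nz z : boundary_value I (phi z) -> phi z != 0.
  by move=> [nI _]; apply/eqP => z0; apply: nI; rewrite z0.
have [kn0|kn0] := posnP (k + n).
  have [H1 H2] := Hf kn0; apply: (blowup_homothetic_regular H1 H2).
    move=> z /nz; rewrite neq_lt => /orP[z0|z0]; [right|left].
      by rewrite mulrN oppr_gt0 nmulr_rlt0.
    by rewrite mulr_gt0.
  have [d Hd] := isoparametric_unit_slope iso kn0.
  by exists (r *: d + 0); rewrite Hd phi0 add0r.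
have [al [al0 phiE _ _]] := isoparametric_quadratic iso kn0.
have al2 : 0 < al ^+ 2 by rewrite exprn_even_gt0.
have al2E : al * al = al ^+ 2 by rewrite expr2.
have snm : (s + n <= m)%N by rewrite -leq_subRL.
have km : (k <= m)%N by apply: leq_trans sm.
case: kn => [k0|n0].
  have n0 : (0 < n)%N by rewrite k0 in kn0.
  have H : abs_tends_as Om u phi (nbhs (al * r)) (pinfty_nbhs R).
    by rewrite phiE k0; apply: abs_tends_scale => //; exact: Hx.
  apply: (blowup_homothetic_regular H H).
    move=> z /nz; rewrite phiE mulf_eq0 negb_or al0/= (ell_x hs hk hn)// => z0.
    left; rewrite mulrACA al2E mulr_gt0// mulr_gt0//.
    by rewrite lt_neqAle eq_sym z0 sqnorm_on_ge0.
  have [z zr] := sphere_nonempty (ltW r0) (x_indices_gt0 snm n0).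
  by exists z; rewrite phiE (ell_x hs hk hn)// zr.
have k0 : (0 < k)%N by rewrite n0 addn0 in kn0.
have H : abs_tends_as Om u phi (nbhs (al * - r)) (pinfty_nbhs R).
  by rewrite phiE n0; apply: abs_tends_scale => //; exact: Ht.
apply: (blowup_homothetic_regular H H).
  move=> z /nz; rewrite phiE mulf_eq0 negb_or al0/= (ell_t hs hk hn)// oppr_eq0 => z0.
  left; rewrite mulrACA al2E mulrNN mulr_gt0// mulr_gt0//.
  by rewrite lt_neqAle eq_sym z0 sqnorm_on_ge0.
have [z zr] := sphere_nonempty (ltW r0) (x_indices_gt0 (s := 0) km k0).
by exists z; rewrite phiE (ell_t hs hk hn)// zr.
Qed.

End Definite.

(** * Solutions with [k] and [n] positive *)

Section Indefinite.
Hypotheses (k0 : (0 < k)%N) (n0 : (0 < n)%N).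

Let kn : (0 < k + n)%N. Proof. by rewrite addn_gt0 k0. Qed.
Let kn2 : (2 <= k + n)%N. Proof. by rewrite -(addn1 1) leq_add. Qed.

Let SxR : set 'rV[R]_m := coord_proj s k n @^-1` pseudosphere k 1.
Let HxR : set 'rV[R]_m := coord_proj s k n @^-1` pseudohyperbolic k 1.

Lemma quadricE (c : R) :
  [set z : 'rV[R]_m | mink k (coord_proj s k n z) (coord_proj s k n z) = c] =
  [set z | ell s k n z = c].
Proof. by apply/seteqP; split=> z /=; rewrite mink_coord_proj. Qed.

Lemma exists_ell (r : R) : exists z : 'rV[R]_m, ell s k n z = r.
Proof.
have sltm : (s < m)%N by case/andP: hs.
have m0 : (0 < m)%N by apply: leq_trans sltm.
have snm : (s + n <= m)%N by rewrite -leq_subRL.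
have km : (k <= m)%N by apply: leq_trans sm.
have s0 : (0 < s)%N by case/andP: hs.
pose it : 'I_m := Ordinal m0; pose ix : 'I_m := Ordinal sltm.
have tt : it \in t_indices m k by rewrite inE.
have tx : it \in x_indices m s n = false by rewrite inE /= leqNgt s0.
have xt : ix \in t_indices m k = false by rewrite inE /= ltnNge hk.
have xx : ix \in x_indices m s n by rewrite inE /= leqnn -[X in (X < _)%N]addn0 ltn_add2l.
have ell0 : ell s k n (0 : 'rV[R]_m) = 0 by apply: ell_vertex => //; exact: vertex0.
have [r0|r0] := leP 0 r.
  exists (Num.sqrt r *: delta_mx 0 ix + 0).
  by rewrite (ell_line_delta hs hk hn) ell0 xx xt mxE sqr_sqrtr// !mulr0 !add0r subr0 mulr1.
exists (Num.sqrt (- r) *: delta_mx 0 it + 0).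
by rewrite (ell_line_delta hs hk hn) ell0 tx tt mxE sqr_sqrtr ?oppr_ge0 ?ltW// !mulr0 !add0r mulrN1 opprK.
Qed.

Lemma exists_phi (t : R) : exists z, phi z = t.
Proof.
have [al [al0 phiE _ _]] := isoparametric_quadratic iso kn.
have [z zr] := exists_ell (al^-1 * t).
by exists z; rewrite phiE zr mulVKf.
Qed.

Lemma domain_open t : I t -> nbhs t I.
Proof.
move=> It; have [->|t0] := eqVneq t 0; last exact: (nbhs_off_zero Irange oOm OmE lift).
have [z1 Hz1] := exists_phi (-1); have [z2 Hz2] := exists_phi 1.
by apply: (nbhs_zero iI I0 oOm OmE lift (z1 := z1) (z2 := z2)); rewrite ?Hz1 ?Hz2 ?ltrN10.
Qed.

Lemma phi_scale (c : R) z : phi (c *: z) = c ^+ 2 * phi z.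
Proof.
have [al [_ -> _ _]] := isoparametric_quadratic iso kn.
by rewrite (ell_scale hs hk hn); ring.
Qed.

(** Close to the vertex there are regular levels on both sides of the cone. *)
Lemma regular_component_in_direction z : phi z != 0 ->
  exists2 c : R, 0 < c &
    regular_component s Om u (connected_component (fibre (c *: z)) (c *: z)).
Proof.
move=> z0; have [al [al0 phiE AE BE]] := isoparametric_quadratic iso kn.
have [del del0 Hdel] := regular_values_near_zero p1 mu0 iI I0 dv dv1 ode v0 al0 kn2
  AE BE domain_open.
pose c := Num.sqrt (del / 2 / `|phi z|).
have zn : 0 < `|phi z| by rewrite normr_gt0.
have c2 : c ^+ 2 = del / 2 / `|phi z|.
  by rewrite sqr_sqrtr// divr_ge0// divr_ge0// ltW.
have c0 : 0 < c by rewrite sqrtr_gt0 !divr_gt0.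
have cz : `|phi (c *: z)| = del / 2.
  by rewrite phi_scale c2 normrM ger0_norm ?divfK ?gt_eqF// ?divr_ge0 ?divr_ge0// ltW.
have [|Icz Hreg] := Hdel (phi (c *: z)).
  rewrite cz; apply/andP; split; lra.
have Ocz : Om (c *: z) by apply/OmP.
exists c => //; exists (u (c *: z)); split; last first.
  by exists (c *: z) => //; rewrite level_component.
left=> w Ow uw gw.
have [w0 v1w] : phi w != 0 /\ v1 (phi w) != 0.
  by apply: Hreg; [exact/OmP|rewrite -!uE].
have /critical_quadraticP[//|//|v1w0|vw] := gw; first by rewrite v1w0 eqxx in v1w.
by move/eqP: w0; apply; rewrite phiE (ell_vertex hs hk hn vw) mulr0.
Qed.

(** Rescaling to [ell = 1] or [ell = -1]; the components of these quadrics need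
    not be identified. *)
Lemma fibre_component_quadric z : phi z != 0 ->
  (0 < ell s k n z ->
     homothetic_to_component s (connected_component (fibre z) z) SxR) /\
  (ell s k n z < 0 ->
     homothetic_to_component s (connected_component (fibre z) z) HxR).
Proof.
move=> z0; have [al [al0 phiE _ _]] := isoparametric_quadratic iso kn.
have fibE : fibre z = [set w | ell s k n w = ell s k n z].
  apply/seteqP; split=> w; rewrite /fibre /= phiE; last by move=> ->.
  by move=> /(mulfI al0).
have key c (Q : set 'rV[R]_m) : 0 < c -> (forall w, fibre z (c *: w) <-> Q w) ->
    homothetic_to_component s (connected_component (fibre z) z) Q.
  move=> c0 H; have cN0 : c != 0 by rewrite gt_eqF.
  have zE : z = c *: (c^-1 *: z) by rewrite scalerA divff// scale1r.
  have Qz : Q (c^-1 *: z) by apply/H; rewrite -zE.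
  exists (connected_component Q (c^-1 *: z)); first by exists (c^-1 *: z).
  by rewrite [X in connected_component _ X]zE; exact: homothetic_component.
split=> lz.
  apply: (key (Num.sqrt (ell s k n z))) => [|w]; first by rewrite sqrtr_gt0.
  rewrite /SxR /pseudosphere /preimage quadricE fibE /= (ell_scale hs hk hn).
  rewrite sqr_sqrtr ?ltW//; split=> [|->]; last by rewrite mulr1.
  by rewrite -[RHS]mulr1 => /mulfI; apply; rewrite gt_eqF.
apply: (key (Num.sqrt (- ell s k n z))) => [|w]; first by rewrite sqrtr_gt0 oppr_gt0.
rewrite /HxR /pseudohyperbolic /preimage quadricE fibE /= (ell_scale hs hk hn).
rewrite sqr_sqrtr ?oppr_ge0 ?ltW//; split=> [|->]; last by rewrite mulrNN mulr1.
move=> E; apply: (mulfI (lt0r_neq0 (_ : 0 < - ell s k n z))).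
  by rewrite oppr_gt0.
by rewrite E mulrNN mulr1.
Qed.

Lemma regular_component_quadric S : regular_component s Om u S ->
  homothetic_to_component s S SxR \/ homothetic_to_component s S HxR.
Proof.
move=> /regular_component_fibre[z [_ -> [E|z0]]]; first by have := kn; rewrite E.
have [al [_ phiE _ _]] := isoparametric_quadratic iso kn.
have [H1 H2] := fibre_component_quadric z0.
have : ell s k n z != 0 by move: z0; rewrite phiE mulf_eq0 negb_or => /andP[].
by rewrite neq_lt => /orP[/H2|/H1]; [right|left].
Qed.

Lemma exists_regular_component (r : R) : r != 0 -> exists z,
  [/\ 0 < r * ell s k n z, phi z != 0 &
      regular_component s Om u (connected_component (fibre z) z)].
Proof.
move=> r0; have [al [al0 phiE _ _]] := isoparametric_quadratic iso kn.
have [z zr] := exists_ell r.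
have z0 : phi z != 0 by rewrite phiE zr mulf_neq0.
have [c c0 Hc] := regular_component_in_direction z0.
exists (c *: z); split=> //; last first.
  by rewrite phi_scale mulf_neq0// expf_neq0// gt_eqF.
rewrite (ell_scale hs hk hn) zr mulrCA -expr2.
by apply: mulr_gt0; [exact: exprn_gt0|rewrite exprn_even_gt0].
Qed.

Lemma both_quadrics_occur :
  (exists2 S, regular_component s Om u S & homothetic_to_component s S SxR) /\
  (exists2 S, regular_component s Om u S & homothetic_to_component s S HxR).
Proof.
split.
  have [z [lz z0 Hz]] := exists_regular_component (oner_neq0 R).
  exists (connected_component (fibre z) z) => //.
  by apply fibre_component_quadric => //; rewrite mul1r in lz.
have N10 : -1 != 0 :> R by rewrite oppr_eq0 oner_eq0.
have [z [lz z0 Hz]] := exists_regular_component N10.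
exists (connected_component (fibre z) z) => //.
by apply fibre_component_quadric => //; rewrite mulN1r oppr_gt0 in lz.
Qed.

(** The component of the origin in its level set is the whole cone, and the
    critical points of [u] on it are those of [ell]. *)
Lemma vertex_critical_part_of_cone :
  critical_part_of_cone s k n Om u (vertex s k n).
Proof.
have [al [al0 phiE _ _]] := isoparametric_quadratic iso kn.
have fibE : fibre 0 = [set w | ell s k n w = 0].
  apply/seteqP; split=> w; rewrite /fibre /= phi0 phiE; last by move=> ->; rewrite mulr0.
  by move=> /eqP; rewrite mulf_eq0 (negbTE al0) => /eqP.
exists (fibre 0), (u 0); split.
- exists 0 => //; rewrite level_component// fibE; apply: esym; apply: component_full.
  move=> w w0; apply: segment_component => t _.
  by rewrite subr0 addr0 /= (ell_scale hs hk hn) w0 mulr0.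
- rewrite /cone /preimage quadricE -fibE; exact: homothetic_refl.
- apply/seteqP; split=> [w vw|w [w0 [Ow gw]]].
    have w0 : phi w = 0 by rewrite phiE (ell_vertex hs hk hn vw) mulr0.
    have Ow : Om w by apply/OmP; rewrite w0.
    split; first by rewrite /fibre /= w0 phi0.
    by split=> //; apply/critical_quadraticP => //; right.
  have /critical_quadraticP[//|//|v1w|//] := gw.
  by have /eqP[] := v1_at_zero kn; rewrite -[X in v1 X]phi0 -w0.
Qed.

Lemma critical_component_quadric V : is_component crit V ->
  [\/ homothetic_to_component s V SxR, homothetic_to_component s V HxR |
      critical_part_of_cone s k n Om u V].
Proof.
move=> /critical_component_cases[[z [_ -> [E|z0]]]|[_ ->]].
- by have := kn; rewrite E.
- have [al [_ phiE _ _]] := isoparametric_quadratic iso kn.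
  have [H1 H2] := fibre_component_quadric z0.
  have : ell s k n z != 0 by move: z0; rewrite phiE mulf_eq0 negb_or => /andP[].
  rewrite neq_lt => /orP[/H2 h|/H1 h]; first by apply: Or32.
  by apply: Or31.
- by apply: Or33; exact: vertex_critical_part_of_cone.
Qed.

Lemma blowup_indefinite : decay_and_blowup s k n Om u ->
  blowup_set Om u !=set0 /\
  (forall C, is_component (blowup_set Om u) C ->
     exists2 S, regular_component s Om u S & homothetic s C S).
Proof.
have [al [al0 phiE _ _]] := isoparametric_quadratic iso kn.
have phiE' z : phi z = al * ell s k n z by rewrite phiE.
have al2 : 0 < al ^+ 2 by rewrite exprn_even_gt0.
have al2E : al * al = al ^+ 2 by rewrite expr2.
(* [q] is the value of [ell] at which [u] blows up, and [Om] reaches beyond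
   every value of [ell] of the opposite sign. *)
have key q : q != 0 -> abs_tends_as Om u (ell s k n) (nbhs q) (pinfty_nbhs R) ->
    (forall x, x * q < 0 -> exists2 z, Om z & ell s k n z * q <= x * q) ->
    blowup_set Om u !=set0 /\
    (forall C, is_component (blowup_set Om u) C ->
       exists2 S, regular_component s Om u S & homothetic s C S).
  move=> q0 Hq far.
  have H : abs_tends_as Om u phi (nbhs (al * q)) (pinfty_nbhs R).
    by rewrite phiE; exact: abs_tends_scale.
  have bnd z : boundary_value I (phi z) -> 0 < phi z * (al * q).
    move=> [nI _].
    have lz : ell s k n z != 0.
      by apply/eqP => lz; apply: nI; rewrite phiE' lz mulr0.
    rewrite phiE' mulrACA al2E pmulr_rgt0//.
    rewrite lt_neqAle eq_sym mulf_neq0//= leNgt; apply/negP => lq; apply: nI.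
    have [w /OmP Iw wz] := far _ lq.
    have h1 : phi w * (al * q) <= phi z * (al * q).
      by rewrite !phiE' !(mulrACA _ _ al) al2E ler_wpM2l// ltW.
    have h2 : phi z * (al * q) < 0 by rewrite phiE' mulrACA al2E pmulr_rlt0.
    have aq : al * q != 0 by rewrite mulf_neq0.
    move: aq; rewrite neq_lt => /orP[aq|aq].
      rewrite ler_nM2r// in h1; rewrite nmulr_llt0// in h2.
      by apply: (iI I0 Iw); rewrite h1 ltW.
    rewrite ler_pM2r// in h1; rewrite pmulr_llt0// in h2.
    by apply: (iI Iw I0); rewrite h1 ltW.
  have [ne comp] := blowup_components H H (fun z bz => or_introl (bnd z bz)).
  have [z0 z0q] := exists_phi (al * q).
  split; first by exists z0; exact: ne.
  move=> C /comp[z [_ zN0 ->]].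
  have [c c0 Hc] := regular_component_in_direction zN0.
  exists (connected_component (fibre (c *: z)) (c *: z)) => //.
  apply: homothetic_sym; apply: homothetic_component => // w.
  rewrite /fibre /= !phi_scale; split=> [|->//].
  by apply: mulfI; rewrite expf_neq0// gt_eqF.
move=> [r r0 [[H1 H2]|[H1 H2]]].
  apply: (key (- r)) => //; first by rewrite oppr_eq0 gt_eqF.
  move=> x xr; have [z Oz xz] := (H1.1) _ (nbhs_pinfty_gt (num_real x)).
  by exists z => //; rewrite !mulrN lerN2 ler_pM2r// ltW.
apply: (key r) => //; first by rewrite gt_eqF.
move=> x xr; have [z Oz xz] := (H1.1) _ (nbhs_ninfty_lt (num_real x)).
by exists z => //; rewrite ler_pM2r// ltW.
Qed.

End Indefinite.

End Solution.
Unset Implicit Arguments.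
Set Strict Implicit.

Theorem theorem1p6 (R : realType) (m s k n : nat)
    (hm : (3 <= m)%N) (hs : (1 <= s < m)%N)
    (hk : (k <= s)%N) (hn : (n <= m - s)%N)
    (p mu : R) (hp : 1 < p) (hmu : mu != 0)
    (Om : set 'rV[R]_m) (u : 'rV[R]_m -> R) :
  let optsI := [set Hyperplane_a; Flat_s; Flat_s1; Parabolic;
                    Flat_x_Sphere; Sphere_x_Flat] in
  let optsII := [set Flat_s; Flat_s1; Flat_x_Sphere; Sphere_x_Flat] in
  let SxR : set 'rV[R]_m := coord_proj s k n @^-1` pseudosphere k 1 in
  let HxR : set 'rV[R]_m := coord_proj s k n @^-1` pseudohyperbolic k 1 in
  [/\ (Y1 s k n p mu Om u \/ Y4 s k n p mu Om u ->
        exactly_one_option s k n Om u optsI /\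
        (forall V, is_component (critical_set s Om u) V ->
           model_or_focal s k n optsI V)),
      (Y4 s k n p mu Om u ->
        blowup_set Om u !=set0 /\
        (forall B S, is_component (blowup_set Om u) B ->
           regular_component s Om u S -> homothetic s B S)),
      (Y2 s k n p mu Om u \/ Y3 s k n p mu Om u ->
        exactly_one_option s k n Om u optsII /\
        (forall V, is_component (critical_set s Om u) V ->
           model_or_focal s k n optsII V)) &
      (Y5 s k n p mu Om u \/ Y6 s k n p mu Om u ->
        [/\ (forall S, regular_component s Om u S ->
               homothetic_to_component s S SxR \/
               homothetic_to_component s S HxR),
            (exists2 S, regular_component s Om u S &
               homothetic_to_component s S SxR) /\
            (exists2 S, regular_component s Om u S &
               homothetic_to_component s S HxR),
            (forall V, is_component (critical_set s Om u) V ->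
               [\/ homothetic_to_component s V SxR,
                   homothetic_to_component s V HxR |
                   critical_part_of_cone s k n Om u V]),
            blowup_set Om u !=set0 &
            (forall B, is_component (blowup_set Om u) B ->
               exists2 S, regular_component s Om u S & homothetic s B S)])].

Proof.
move=> optsI optsII SxR HxR.
have open_sol : forall phi, reduced_solution s k n p mu phi Om u ->
    exists A B I v v1 v2,
    [/\ isoparametric s k n phi A B, is_interval I, I 0 & I `<=` range phi] /\
    [/\ forall t, I t -> deriv_within I v t (v1 t),
        forall t, I t -> deriv_within I v1 t (v2 t),
        forall t, I t -> A t * v2 t + B * v1 t = - mu * `|v t| `^ (p - 1) * v t &
        0 < v 0] /\
    [/\ Om = phi @^-1` I, forall z, Om z -> u z = v (phi z) & open Om].
  move=> phi [A [B [I [v [iso [iI I0 IR [v1 [v2 [dv dv1 _ ode _]]] _] v0 OmE [uE [oOm _]]]]]]].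
  by exists A, B, I, v, v1, v2.
have definite (opts : set option_name) phi : reduced_solution s k n p mu phi Om u ->
    k = 0%N \/ n = 0%N ->
    ((k + n = 0)%N -> opts Hyperplane_a /\ opts Parabolic) ->
    [/\ opts Flat_s, opts Flat_s1, opts Flat_x_Sphere & opts Sphere_x_Flat] ->
    exactly_one_option s k n Om u opts /\
    (forall V, is_component (critical_set s Om u) V -> model_or_focal s k n opts V).
  move=> /open_sol[A [B [I [v [v1 [v2]]]]]].
  move=> [[iso iI I0 IR] [[dv dv1 ode v0] [OmE uE oOm]]] kn.
  exact: (level_and_critical_sets hs hk hn hp hmu iso iI I0 dv dv1 ode v0 OmE uE oOm kn).
have inI : [/\ optsI Flat_s, optsI Flat_s1, optsI Flat_x_Sphere & optsI Sphere_x_Flat].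
  by split; rewrite /optsI /=; tauto.
have inI0 : (k + n = 0)%N -> optsI Hyperplane_a /\ optsI Parabolic.
  by split; rewrite /optsI /=; tauto.
have inII : [/\ optsII Flat_s, optsII Flat_s1, optsII Flat_x_Sphere & optsII Sphere_x_Flat].
  by split; rewrite /optsII /=; tauto.
split.
- move=> [[phi [red kn _ _ _]]|[phi [red kn _ _ _]]]; last exact: definite red kn inI0 inI.
  apply: definite red _ inI0 inI.
  by case: (k) (n) kn => [|[|k']] [|n'] //; auto.
- move=> [phi [/open_sol[A [B [I [v [v1 [v2]]]]]]]].
  move=> [[iso iI I0 IR] [[dv dv1 ode v0] [OmE uE oOm]]] kn _ _ [r r0 [Hx Ht Hf]].
  exact: (blowup_definite hs hk hn hp hmu iso iI I0 IR dv dv1 ode v0 OmE uE oOm kn r0).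
- have not0 : (2 <= k + n)%N -> (k + n = 0)%N -> optsII Hyperplane_a /\ optsII Parabolic.
    by move=> + kn; rewrite kn.
  move=> [[phi [red [kn2 kn _] _ _ _]]|[phi [red [kn2 kn _] _ _ _]]].
    exact: definite red kn (not0 kn2) inII.
  exact: definite red kn (not0 (ltnW kn2)) inII.
- move=> H.
  have [phi [red k0 n0 Hd]] : exists phi, [/\ reduced_solution s k n p mu phi Om u,
      (0 < k)%N, (0 < n)%N & decay_and_blowup s k n Om u].
    by case: H => -[phi [red [_ k0 n0 _] _ _ Hd]]; exists phi.
  have [A [B [I [v [v1 [v2]]]]]] := open_sol _ red.
  move=> [[iso iI I0 IR] [[dv dv1 ode v0] [OmE uE oOm]]].
  have [ne bl] := blowup_indefinite hs hk hn hp hmu iso iI I0 IR dv dv1 ode v0 OmE uE oOm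
    k0 n0 Hd.
  split=> //.
  + exact: (regular_component_quadric hs hk hn hp hmu iso iI I0 dv dv1 ode v0 OmE uE oOm k0).
  + exact: (both_quadrics_occur hs hk hn hp hmu iso iI I0 IR dv dv1 ode v0 OmE uE oOm k0 n0).
  + exact: (critical_component_quadric hs hk hn hp hmu iso iI I0 dv dv1 ode v0 OmE uE oOm k0).
Qed.
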